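(* Let $G$ be a finite simple quasi 5-connected graph. If $d_G(x)+d_G(y)\ge 9$ for every pair $x,y$ of vertices of $G$ at distance one or two, then $G$ contains a quasi 5-contractible edge.
   Context: All graphs are finite, simple and undirected; $d_G(x)$ is the degree of $x$, and the distance between two vertices is the length of a shortest path between them. For an edge $e=xy$, $G/e$ denotes the graph obtained by deleting $e$, identifying $x$ and $y$, and replacing any resulting multiple edges by single edges. A cut of a connected graph $G$ is a set $T\subseteq V(G)$ with $G-T$ disconnected; a $k$-cut is a cut with $k$ vertices. A $k$-cut $T$ is nontrivial if the components of $G-T$ can be partitioned into two subgraphs $G_1,G_2$ with $|V(G_1)|\ge 2$ and $|V(G_2)|\ge 2$. A graph is quasi $k$-connected if it is $(k-1)$-connected and has no nontrivial $(k-1)$-cut. An edge $e$ of a quasi $k$-connected graph $G$ is quasi $k$-contractible if $G/e$ is quasi $k$-connected. *)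

(* Defs.v *)
From mathcomp Require Import all_boot.

Set Implicit Arguments.
Unset Strict Implicit.
Unset Printing Implicit Defensive.

Record sgraph := SGraph {
  svertex :> finType;
  sedge : rel svertex;
  sedge_sym : symmetric sedge;
  sedge_irr : irreflexive sedge
}.

Notation "x -- y" := (sedge x y) (at level 30, no associativity).

Definition deg (G : sgraph) (x : G) : nat := #|[set y : G | x -- y]|.

(* [is_dist x y n]: the distance between [x] and [y] exists and equals [n].
   A path from [x] is represented, as in path.v, by the sequence of its
   vertices other than [x], whose size is the length of the path. *)
Definition is_path_to (G : sgraph) (x y : G) (p : seq G) : bool :=
  [&& path (@sedge G) x p, uniq (x :: p) & last x p == y].

Definition is_dist (G : sgraph) (x y : G) (n : nat) : Prop :=
  (exists2 p, is_path_to x y p & size p = n) /\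
  (forall p, is_path_to x y p -> n <= size p).

(* Adjacency in [G - T]; the vertices of [G - T] are those of [~: T]. *)
Definition del_edge (G : sgraph) (T : {set G}) : rel G :=
  [rel u v | [&& u \notin T, v \notin T & u -- v]].

Definition components (G : sgraph) (T : {set G}) : {set {set G}} :=
  equivalence_partition (connect (del_edge T)) (~: T).

Definition is_cut (G : sgraph) (T : {set G}) : Prop :=
  exists u v : G, [/\ u \notin T, v \notin T & ~~ connect (del_edge T) u v].

Definition nontrivial_cut (G : sgraph) (k : nat) (T : {set G}) : Prop :=
  [/\ #|T| = k, is_cut T &
      exists C1 C2 : {set {set G}},
        [/\ C1 :|: C2 = components T, [disjoint C1 & C2],
            2 <= #|cover C1| & 2 <= #|cover C2|]].

Definition k_connected (k : nat) (G : sgraph) : Prop :=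
  k < #|G| /\ (forall T : {set G}, #|T| < k -> ~ is_cut T).

Definition quasi_connected (k : nat) (G : sgraph) : Prop :=
  k_connected k.-1 G /\ (forall T : {set G}, ~ nontrivial_cut k.-1 T).

(* For an edge [x -- y], the vertices of [G / xy] are those of [G] other than
   [y], with [x] playing the role of the vertex obtained by identifying [x]
   and [y]; [merge x y] is the quotient map. *)
Section Contraction.
Variables (G : sgraph) (x y : G).

Definition merge (a : G) : G := if a == y then x else a.

Definition contract_vertex : finType := {z : G | z != y}.

Definition contract_edge : rel contract_vertex :=
  fun u v => (u != v) &&
    [exists a : G, exists b : G,
       [&& merge a == val u, merge b == val v & a -- b]].

Lemma contract_edge_sym : symmetric contract_edge.
Proof.
move=> u v; rewrite /contract_edge eq_sym; congr (_ && _).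
by apply/existsP/existsP => -[a /existsP [b /and3P [ha hb ab]]];
  exists b; apply/existsP; exists a; rewrite ha hb sedge_sym.
Qed.

Lemma contract_edge_irr : irreflexive contract_edge.
Proof. by move=> u; rewrite /contract_edge eqxx. Qed.

Definition contract : sgraph := SGraph contract_edge_sym contract_edge_irr.

End Contraction.

Definition quasi_contractible (k : nat) (G : sgraph) (x y : G) : Prop :=
  x -- y /\ quasi_connected k (contract x y).

(* Main.v *)
(** Suppose that no edge can be contracted. Then for every edge xy either x and y have a common
    neighbour of degree four, or x and y lie in a 5-cut T having at least two vertices on each
    side. The degree condition keeps vertices of degree four at distance at least three from
    each other, so that, near such a vertex or when there is none, every crossing of two such
    cuts has the usual submodularity consequences. The key one: if z in T has a single neighbour
    a on the side A of T, then crossing T with a cut through z and a gives |A| = 2.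

    A vertex z of degree four has a single neighbour on some side of every cut through z and one
    of its neighbours. This yields two such sides {a, a'} and {x, x'}, each contained in the cut of
    the other, and implies that no neighbour of z has two neighbours in common with z. A cut
    through a and x' then produces a second vertex of degree four violating the latter.

    If all degrees are at least five, a smallest side A of a cut T containing an edge is a pair
    {p, q}. Both p and q turn out to be complete to T, and every t in T lies in a cut through p, q
    and t that splits T - t into two pairs; hence T induces a matching. If xy is an edge in T and
    T = {x, y, t, t', i}, then crossing the cuts obtained from t and t' shows that {t', i} or {t, i}
    is a side of a cut containing p, q and t, resp. t', and this cut does not induce a matching. *)

Require Import Defs.
From mathcomp Require Import all_boot.
From mathcomp Require Import zify.

Set Implicit Arguments.
Unset Strict Implicit.
Unset Printing Implicit Defensive.

Ltac split_eqs w := repeat match goal with |- context [w == ?x] => case: (w == x) => //= end.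

Ltac split_andb :=
  repeat match goal with h : is_true (_ && _) |- _ => case/andP: h => ? ? end.

Ltac rewrite_neqs :=
  rewrite ?eqxx; repeat match goal with
  | h : is_true (?x != ?y) |- context [?x == ?y] => rewrite (negbTE h)
  | h : is_true (?x != ?y) |- context [?y == ?x] => rewrite (eq_sym y x) (negbTE h)
  end; rewrite ?eqxx ?orbT ?orbF ?andbT ?andbF //.

Ltac hub_neqs H :=
  let u := fresh "u" in
  have u := hub_uniq H; rewrite /= !inE !negb_or in u; split_andb.

Lemma set_rest (T : finType) (S : {set T}) (l : seq T) :
  uniq l -> {subset l <= S} ->
  exists r, [/\ size r = #|S| - size l, uniq (l ++ r) & forall w, (w \in S) = (w \in l ++ r)].
Proof.
move=> ul sl; pose r := [seq w <- enum S | w \notin l].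
have ulr : uniq (l ++ r).
  rewrite cat_uniq ul filter_uniq ?enum_uniq // andbT /=; apply/hasPn => w.
  by rewrite mem_filter => /andP [].
have e w : (w \in S) = (w \in l ++ r).
  rewrite mem_cat mem_filter mem_enum; case wl: (w \in l) => //=; exact: sl.
by exists r; split=> //; rewrite (eq_card e) (card_uniqP ulr) size_cat addKn.
Qed.

Lemma card_ge_uniq (T : finType) (S : {set T}) (l : seq T) :
  uniq l -> {subset l <= S} -> size l <= #|S|.
Proof.
move=> ul sl; rewrite -(card_uniqP ul); apply: subset_leq_card.
by apply/subsetP => w; apply: sl.
Qed.

(** * Separations *)

Section Separations.
Variable G : sgraph.
Implicit Types (A B C D T : {set G}) (u v w : G).

Definition sep A B : bool :=
  [disjoint A & B] && [forall u in A, forall v in B, ~~ u -- v].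

Definition cutset A B : {set G} := ~: (A :|: B).

(* [cutset A B] is then a nontrivial 5-cut, with sides [A] and [B]. *)
Definition fivesep A B : bool :=
  [&& sep A B, #|cutset A B| == 5, 1 < #|A| & 1 < #|B|].

Definition nbrs u : {set G} := [set v | u -- v].

Definition quasi5 : Prop :=
  [/\ forall A B, sep A B -> A != set0 -> B != set0 -> 4 <= #|cutset A B|
    & forall A B, sep A B -> 1 < #|A| -> 1 < #|B| -> 5 <= #|cutset A B|].

Lemma sepP A B :
  reflect ((forall v, v \in A -> v \notin B) /\
           (forall u v, u \in A -> v \in B -> u -- v = false)) (sep A B).
Proof.
apply: (iffP andP) => -[dAB nAB]; split.
- by move=> v vA; rewrite (disjointFr dAB vA).
- move=> u v uA vB; apply/negbTE.
  by move/forall_inP: nAB => /(_ u uA) /forall_inP /(_ v vB).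
- by rewrite disjoint_subset; apply/subsetP => v /dAB.
- by apply/forall_inP => u uA; apply/forall_inP => v vB; rewrite nAB.
Qed.

Lemma sepC A B : sep A B = sep B A.
Proof.
have imp X Y : sep X Y -> sep Y X.
  case/sepP => d n; apply/sepP; split => [v|u v uY vX].
    by apply: contraL => /d.
  by rewrite sedge_sym n.
by apply/idP/idP; apply: imp.
Qed.

Lemma cutsetC A B : cutset A B = cutset B A.
Proof. by rewrite /cutset setUC. Qed.

Lemma in_cutset A B v : (v \in cutset A B) = (v \notin A) && (v \notin B).
Proof. by rewrite !inE negb_or. Qed.

Lemma fivesepC A B : fivesep A B = fivesep B A.
Proof. by rewrite /fivesep sepC cutsetC andbA [RHS]andbA; congr (_ && _); rewrite andbC. Qed.

Lemma fivesep_sep A B : fivesep A B -> sep A B.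
Proof. by case/andP. Qed.

Lemma fivesep_card A B : fivesep A B -> #|cutset A B| = 5.
Proof. by case/and4P => _ /eqP. Qed.

Lemma del_edge_sym T : connect_sym (del_edge T).
Proof.
apply: sym_connect_sym => u v; rewrite /del_edge /= sedge_sym.
by case: (u \in T); case: (v \in T).
Qed.

Lemma sep_connect A B T u v :
  sep A B -> A :|: B = ~: T -> u \in A -> connect (del_edge T) u v -> v \in A.
Proof.
move=> /sepP [d n] AB uA /connectP [p pth ->].
elim: p u uA pth => //= w p IH u uA /andP [/and3P [uT wT uw]]; apply: IH.
have : w \in A :|: B by rewrite AB inE.
by case/setUP => // wB; rewrite n in uw.
Qed.

Lemma is_cutP T :
  is_cut T <->
  exists A B, [/\ sep A B, A :|: B = ~: T, A != set0 & B != set0].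
Proof.
split.
  case=> u [v [uT vT nuv]].
  exists [set w | (w \notin T) && connect (del_edge T) u w].
  exists [set w | (w \notin T) && ~~ connect (del_edge T) u w].
  split.
  - apply/sepP; split=> [w|w w']; rewrite !inE; first by case/andP => -> ->.
    case/andP => wT cw /andP [w'T]; apply: contraNF => ww'.
    by apply: (connect_trans cw); apply: connect1; rewrite /del_edge /= wT w'T.
  - by apply/setP => w; rewrite !inE; case: (w \in T); case: connect.
  - by apply/set0Pn; exists u; rewrite inE uT connect0.
  - by apply/set0Pn; exists v; rewrite inE vT.
case=> A [B [sAB AB /set0Pn [u uA] /set0Pn [v vB]]].
have inT w : w \in A :|: B -> w \notin T by rewrite AB inE.
exists u, v; split; try by apply: inT; rewrite inE ?uA ?vB ?orbT.
apply/negP => /(sep_connect sAB AB uA) vA.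
by move/sepP: sAB => [/(_ v vA)]; rewrite vB.
Qed.

Lemma components_partition T : partition (components T) (~: T).
Proof.
apply: equivalence_partitionP => u v w _ _ _; split=> [|uv]; first exact: connect0.
exact: (same_connect (@del_edge_sym T) uv).
Qed.

Lemma nontrivial_cutP k T :
  nontrivial_cut k T <->
  #|T| = k /\ exists A B, [/\ sep A B, A :|: B = ~: T, 1 < #|A| & 1 < #|B|].
Proof.
have inC (X : {set {set G}}) w P : P \in X -> w \in P -> w \in cover X.
  by move=> PX wP; apply/bigcupP; exists P.
split.
  case=> cT _ [C1 [C2 [C12 d12 C1_gt1 C2_gt1]]]; split=> //.
  have /and3P [/eqP covT trivT _] := components_partition T.
  exists (cover C1), (cover C2); split=> //; last first.
    by rewrite -covT -C12 /cover bigcup_setU.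
  have sub1 P : P \in C1 -> P \in components T by rewrite -C12 inE => ->.
  have sub2 P : P \in C2 -> P \in components T by rewrite -C12 inE => ->; rewrite orbT.
  have same u v P Q : P \in C1 -> Q \in C2 -> u \in P -> v \in Q -> ~ connect (del_edge T) u v.
    move=> P1 Q2 uP vQ cuv.
    have PT := sub1 _ P1; have QT := sub2 _ Q2.
    case/imsetP: (PT) => u0 _ defP; case/imsetP: (QT) => v0 _ defQ.
    move: uP; rewrite defP inE => /andP [_ cu].
    have vT : v \in ~: T by rewrite -covT (inC _ _ _ QT).
    have vP : v \in P by rewrite defP inE vT (connect_trans cu cuv).
    have PQ : P = Q by rewrite -(def_pblock trivT PT vP) (def_pblock trivT QT vQ).
    by rewrite -PQ (disjointFr d12 P1) in Q2.
  apply/sepP; split=> [v|u v] /bigcupP [P P1 uP].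
    apply/negP => /bigcupP [Q Q2 vQ].
    by apply: (same _ _ _ _ P1 Q2 uP vQ); rewrite connect0.
  case/bigcupP => Q Q2 vQ; apply/negP => uv; apply: (same _ _ _ _ P1 Q2 uP vQ).
  have inT w (R : {set G}) : w \in R -> R \in components T -> w \notin T.
    by move=> wR RT; move: (inC _ _ _ RT wR); rewrite covT inE.
  by apply: connect1; rewrite /del_edge /= (inT _ _ uP (sub1 _ P1)) (inT _ _ vQ (sub2 _ Q2)).
case=> cT [A [B [sAB AB A_gt1 B_gt1]]].
have cutT : is_cut T.
  by apply/is_cutP; exists A, B; split=> //; rewrite -card_gt0 ltnW.
have sBA : sep B A by rewrite sepC.
have BA : B :|: A = ~: T by rewrite setUC.
split=> //.
pose blocks A := [set P in components T | P \subset A].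
have cov A' B' : sep A' B' -> A' :|: B' = ~: T -> cover (blocks A') = A'.
  move=> s e; apply/setP => v; apply/bigcupP/idP => [[P]|vA].
    by rewrite inE => /andP [_ /subsetP sP] /sP.
  have vT : v \in ~: T by rewrite -e inE vA.
  exists [set w in ~: T | connect (del_edge T) v w]; last by rewrite inE vT connect0.
  rewrite inE; apply/andP; split; first by apply/imsetP; exists v.
  by apply/subsetP => w; rewrite inE => /andP [_] /(sep_connect s e vA).
exists (blocks A), (blocks B); split; rewrite ?(cov A B) ?(cov B A) //.
  apply/setP => P; rewrite !inE -andb_orr; case PT: (P \in _) => //=.
  case/imsetP: PT => v; rewrite -AB => /setUP [vA|vB] ->; apply/orP; [left|right];
    by apply/subsetP => w; rewrite inE => /andP [_]; apply: sep_connect; eassumption.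
rewrite disjoint_subset; apply/subsetP => P; rewrite !inE => /andP [PT /subsetP PA].
apply/nandP; right; apply/negP => /subsetP PB.
case/imsetP: PT => v vT defP.
have vP : v \in P by rewrite defP inE vT connect0.
by move/sepP: sAB => [/(_ v (PA _ vP))]; rewrite PB.
Qed.

Lemma cutset_def A B T : A :|: B = ~: T -> cutset A B = T.
Proof. by rewrite /cutset => ->; rewrite setCK. Qed.

Lemma quasi_connected_quasi5 : quasi_connected 5 G -> quasi5.
Proof.
case=> [[_ conn] noT]; split=> A B sAB nA nB.
  rewrite leqNgt; apply/negP => lt4; apply: (conn _ lt4); apply/is_cutP.
  by exists A, B; split=> //; rewrite setCK.
have: 4 <= #|cutset A B|.
  rewrite leqNgt; apply/negP => lt4; apply: (conn _ lt4); apply/is_cutP.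
  by exists A, B; split; rewrite -?card_gt0 ?setCK // ltnW.
rewrite leq_eqVlt => /orP [/eqP e|//]; case: (noT (cutset A B)).
by apply/nontrivial_cutP; split=> //; exists A, B; split; rewrite ?setCK.
Qed.

Lemma nbrs_cutset A B v :
  sep A B -> A = [set v] -> nbrs v \subset cutset A B.
Proof.
move=> /sepP [d n] Av; apply/subsetP => w; rewrite inE => vw.
have vA : v \in A by rewrite Av set11.
rewrite in_cutset; apply/andP; split.
  by rewrite Av inE; apply: contraTneq vw => ->; rewrite sedge_irr.
by apply: contraTN vw => wB; rewrite n.
Qed.

Hypothesis qG : quasi5.
Hypothesis oG : 4 < #|G|.

Lemma deg_ge4 v : 4 <= deg v.
Proof.
rewrite leqNgt; apply/negP => lt4.
pose B := ~: (v |: nbrs v).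
have sv : sep [set v] B.
  apply/sepP; split=> [u|u w]; rewrite !inE => /eqP ->; first by rewrite eqxx.
  by rewrite negb_or => /andP [_ /negbTE].
have le4 : #|v |: nbrs v| <= 4 by rewrite cardsU1; move: lt4; rewrite /deg -/(nbrs v); lia.
have n0 : B != set0.
  by rewrite -card_gt0; have := cardsC (v |: nbrs v); rewrite -/B; lia.
have := qG.1 _ _ sv; rewrite -card_gt0 cards1 => /(_ isT n0).
have -> : cutset [set v] B = nbrs v.
  apply/setP => w; rewrite in_cutset !inE negbK.
  by case: eqP => [->|_] //=; rewrite sedge_irr.
by rewrite leqNgt -/(deg v) lt4.
Qed.

Lemma nbrs_eq_cutset A B v :
  sep A B -> A = [set v] -> #|cutset A B| <= 4 -> nbrs v = cutset A B /\ deg v = 4.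
Proof.
move=> sAB Av le4; have sub := nbrs_cutset sAB Av.
have d4 := deg_ge4 v; rewrite /deg -/(nbrs v) in d4 *.
have e : nbrs v = cutset A B.
  by apply/eqP; rewrite eqEcard sub /=; lia.
by split=> //; have := subset_leq_card sub; lia.
Qed.

Lemma small_side A B :
  sep A B -> A != set0 -> 1 < #|B| -> #|cutset A B| <= 4 ->
  exists m, [/\ A = [set m], nbrs m = cutset A B & deg m = 4].
Proof.
move=> sAB A0 B1 le4.
have /cards1P [m Am] : #|A| == 1.
  rewrite eqn_leq card_gt0 A0 andbT leqNgt; apply/negP => A1.
  by have := qG.2 _ _ sAB A1 B1; lia.
by exists m; have [] := nbrs_eq_cutset sAB Am le4.
Qed.

Lemma small_closed (X : {set G}) (s : seq G) :
  (forall v w, v \in X -> v -- w -> (w \in X) || (w \in s)) ->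
  (forall v, v \in X -> v \notin s) ->
  1 < #|~: (X :|: [set w in s])| -> size s <= 4 -> X != set0 ->
  exists m, [/\ X = [set m], deg m = 4 & forall w, (m -- w) = (w \in s)].
Proof.
move=> cl dis big sz X0; pose F := ~: (X :|: [set w in s]).
have sXF : sep X F.
  apply/sepP; split=> [v vX|v w vX]; rewrite !inE ?vX //.
  by rewrite negb_or => /andP [wX ws]; apply: contraNF wX => /(cl _ _ vX); rewrite (negbTE ws) orbF.
have cXF : cutset X F = [set w in s].
  apply/setP => w; rewrite in_cutset !inE negbK; case wX: (w \in X) => //=.
  by rewrite (negbTE (dis _ wX)).
have [|m [Xm Nm dm]] := small_side sXF X0 big.
  by rewrite cXF cardsE; apply: leq_trans sz; apply: card_size.
by exists m; split=> // w; move/setP: Nm => /(_ w); rewrite cXF !inE.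
Qed.

End Separations.

(** * Contraction of an edge *)

Section Contraction.
Variables (G : sgraph) (x y : G).
Hypothesis xy : x -- y.

Let neq_xy : x != y.
Proof. by apply: contraTneq xy => ->; rewrite sedge_irr. Qed.

Lemma merge_neq a : Defs.merge x y a != y.
Proof. by rewrite /Defs.merge; case: (eqVneq a y). Qed.

Definition proj a : contract x y := exist (fun z => z != y) (Defs.merge x y a) (merge_neq a).

Lemma proj_val (u : contract x y) : proj (val u) = u.
Proof. by apply: val_inj; rewrite /= /Defs.merge (negbTE (valP u)). Qed.

Lemma proj_xy : proj y = proj x.
Proof. by apply: val_inj; rewrite /= /Defs.merge eqxx; case: eqP. Qed.

Lemma sep_preim (A B : {set contract x y}) :
  sep A B -> sep (proj @^-1: A) (proj @^-1: B).
Proof.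
move=> /sepP [d n]; apply/sepP; split=> [a|a b]; rewrite !inE; first exact: d.
move=> aA bB; apply: contraFF (n _ _ aA bB) => ab.
rewrite /= /contract_edge; apply/andP; split.
  by apply: contraTneq aA => ->; apply: contraL bB => /d.
by apply/existsP; exists a; apply/existsP; exists b; rewrite !eqxx.
Qed.

Lemma cutset_preim (A B : {set contract x y}) :
  cutset (proj @^-1: A) (proj @^-1: B) = proj @^-1: cutset A B.
Proof. by rewrite /cutset preimsetC preimsetU. Qed.

Lemma card_preim_ge (A : {set contract x y}) : #|A| <= #|proj @^-1: A|.
Proof.
rewrite -(card_imset A val_inj); apply: subset_leq_card.
by apply/subsetP => _ /imsetP [u uA ->]; rewrite inE proj_val.
Qed.

Lemma card_preim_le (T : {set contract x y}) :
  #|proj @^-1: T| <= #|T| + ((x \in proj @^-1: T) && (y \in proj @^-1: T)).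
Proof.
have sub a : a \in proj @^-1: T -> a != y -> a \in val @: T.
  rewrite inE => aT ay; apply/imsetP; exists (proj a) => //.
  by rewrite /= /Defs.merge (negbTE ay).
rewrite !inE proj_xy andbb; case xT: (proj x \in T); rewrite -(card_imset T val_inj).
  rewrite addnC; apply: leq_trans (_ : #|y |: val @: T| <= _); last by rewrite cardsU1; case: (_ \notin _).
  apply: subset_leq_card; apply/subsetP => a aT; rewrite !inE.
  by case: (eqVneq a y) => //= ay; apply: sub.
rewrite addn0; apply: subset_leq_card; apply/subsetP => a aT; apply: sub => //.
by apply: contraTneq aT => ->; rewrite inE proj_xy xT.
Qed.

Lemma quasi_contractible_edge :
  quasi5 G -> 5 < #|G| ->
  (forall z, z -- x -> z -- y -> deg z != 4) ->
  (forall A B : {set G}, fivesep A B -> x \in cutset A B -> y \notin cutset A B) ->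
  quasi_contractible 5 x y.
Proof.
move=> qG oG no4 no5; split=> //.
have pos (A : {set contract x y}) : A != set0 -> proj @^-1: A != set0.
  by rewrite -!card_gt0 => /leq_trans; apply; apply: card_preim_ge.
have key A B (T : {set contract x y}) n : #|T| <= n -> sep A B -> A :|: B = ~: T ->
  [/\ sep (proj @^-1: A) (proj @^-1: B),
      #|cutset (proj @^-1: A) (proj @^-1: B)| <=
      n + ((x \in cutset (proj @^-1: A) (proj @^-1: B)) &&
              (y \in cutset (proj @^-1: A) (proj @^-1: B))) &
      1 < #|A| -> 1 < #|B| -> 1 < #|proj @^-1: A| /\ 1 < #|proj @^-1: B|].
  move=> Tn sAB AB; rewrite cutset_preim (cutset_def AB); split.
  - exact: sep_preim.
  - by apply: leq_trans (card_preim_le T) _; rewrite leq_add2r.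
  - by move=> A1 B1; split; apply: leq_trans (card_preim_ge _).
split; [split|].
- have -> : #|contract x y| = #|G|.-1; last by lia.
  by rewrite /= card_sig -(cardC1 y); apply: eq_card => z.
- move=> T T4 /is_cutP [A [B [sAB AB A0 B0]]].
  have [s le _] := key _ _ _ 3 T4 sAB AB.
  move: s le (pos _ A0) (pos _ B0); set A' := _ @^-1: A; set B' := _ @^-1: B.
  move=> s le A'0 B'0.
  have ge := qG.1 _ _ s A'0 B'0.
  have [xT yT e4] : [/\ x \in cutset A' B', y \in cutset A' B' & #|cutset A' B'| <= 4].
    move: le; case: andP => [[xT yT]|_] /= le; first by [].
    by exfalso; move: le ge; lia.
  have single A1 B1 m : sep A1 B1 -> cutset A1 B1 = cutset A' B' -> A1 = [set m] -> False.
    move=> s1 e1 Am; have [|N d] := nbrs_eq_cutset qG (ltnW oG) s1 Am; first by rewrite e1.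
    have mx : m -- x by have := xT; rewrite -e1 -N inE.
    have my : m -- y by have := yT; rewrite -e1 -N inE.
    by have := no4 m mx my; rewrite d.
  case: (leqP #|A'| 1) => [A1|A1].
    have /cards1P [m Am] : #|A'| == 1 by rewrite eqn_leq A1 card_gt0.
    exact: single s erefl Am.
  case: (leqP #|B'| 1) => [B1|B1].
    have /cards1P [m Bm] : #|B'| == 1 by rewrite eqn_leq B1 card_gt0.
    by apply: single Bm; [rewrite sepC; exact: s | rewrite cutsetC].
  by have := qG.2 _ _ s A1 B1; lia.
- move=> T /nontrivial_cutP [T4 [A [B [sAB AB A1 B1]]]].
  have [s le /(_ A1 B1) [A'1 B'1]] := key _ _ _ 4 (eq_leq T4) sAB AB.
  have ge := qG.2 _ _ s A'1 B'1.
  have [xT yT e5] : [/\ x \in cutset (proj @^-1: A) (proj @^-1: B),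
     y \in cutset (proj @^-1: A) (proj @^-1: B) &
     #|cutset (proj @^-1: A) (proj @^-1: B)| = 5].
    move: le; case: andP => [[xT yT]|_] /= le; last by have := leq_trans ge le.
    by split=> //; apply/eqP; rewrite eqn_leq le.
  have := no5 (proj @^-1: A) (proj @^-1: B); rewrite /fivesep s e5 A'1 B'1 => /(_ isT xT).
  by rewrite yT.
Qed.

End Contraction.

(** * Crossing separations *)

Section Crossing.
Variable G : sgraph.
Implicit Types (A B C D T X : {set G}) (u v w z : G).

Lemma sep_disj A B v : sep A B -> v \in A -> (v \in B) = false.
Proof. by case/sepP => d _ /d /negbTE. Qed.

Lemma sep_noedge A B u v : sep A B -> u \in A -> v \in B -> (u -- v) = false.
Proof. by case/sepP => _; apply. Qed.

Lemma sep_intro A B :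
  (forall v, v \in A -> v \in B -> False) ->
  (forall u v, u \in A -> v \in B -> u -- v -> False) -> sep A B.
Proof.
move=> d n; apply/sepP; split=> [v vA|u v uA vB]; first by apply/negP => /(d _ vA).
by apply/negP => /(n _ _ uA vB).
Qed.

Lemma sep_nbr A B u v : sep A B -> u \in A -> u -- v -> v \notin B.
Proof. by move=> sAB uA; apply: contraTN => vB; rewrite (sep_noedge sAB uA vB). Qed.

Lemma sep_false A B u v : sep A B -> u \in A -> v \in B -> u -- v -> False.
Proof. by move=> s uA vB; rewrite (sep_noedge s uA vB). Qed.

Lemma cutsetNl A B v : v \in cutset A B -> (v \in A) = false.
Proof. by rewrite in_cutset => /andP [/negbTE]. Qed.

Lemma cutsetNr A B v : v \in cutset A B -> (v \in B) = false.
Proof. by rewrite in_cutset => /andP [_ /negbTE]. Qed.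

Lemma sep_neq A B u v : sep A B -> u \in A -> v \in B -> u != v.
Proof. by move=> s uA vB; apply: contraTneq uA => ->; apply: contraL vB => vA; rewrite (sep_disj s vA). Qed.

Lemma cutset_neql A B u v : u \in A -> v \in cutset A B -> u != v.
Proof. by move=> uA; apply: contraTneq => <-; rewrite in_cutset uA. Qed.

Lemma cutset_neqr A B u v : u \in B -> v \in cutset A B -> u != v.
Proof. by move=> uB; apply: contraTneq => <-; rewrite in_cutset uB andbF. Qed.

Lemma in_rest A B w : w \notin A -> w \notin cutset A B -> w \in B.
Proof. by rewrite in_cutset negb_and !negbK => /negbTE ->. Qed.

Lemma fivesep_orient C D w :
  fivesep C D -> (w \in C) || (w \in D) ->
  exists C' D', [/\ fivesep C' D', cutset C' D' = cutset C D & w \in C'].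
Proof.
move=> f /orP [wC|wD]; first by exists C, D.
by exists D, C; rewrite fivesepC cutsetC.
Qed.

Lemma deg_le_list v (s : seq G) : (forall w, v -- w -> w \in s) -> deg v <= size s.
Proof.
move=> sub; apply: leq_trans (card_size s); apply: subset_leq_card.
by apply/subsetP => w; rewrite inE; apply: sub.
Qed.

Lemma nbrs_list v (s : seq G) :
  size s <= deg v -> (forall w, v -- w -> w \in s) -> forall w, (v -- w) = (w \in s).
Proof.
move=> dv sub w; apply/idP/idP; first exact: sub.
have eN : nbrs v = [set x in s].
  apply/eqP; rewrite eqEcard; apply/andP; split.
    by apply/subsetP => x; rewrite !inE; apply: sub.
  by rewrite cardsE; apply: leq_trans (card_size _) _.
by move/setP/(_ w): eN; rewrite !inE => ->.
Qed.

Lemma card_split X C D :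
  sep C D -> #|X| = #|X :&: C| + #|X :&: cutset C D| + #|X :&: D|.
Proof.
move=> sCD; rewrite -(cardsID C X) -addnA; congr (_ + _).
rewrite -(cardsID D (X :\: C)) addnC; congr (_ + _); apply: eq_card => v;
  rewrite !inE; first by rewrite negb_or; case: (v \in C); case: (v \in D); case: (v \in X).
by case vC: (v \in C) => //=; rewrite (sep_disj sCD vC) andbF.
Qed.

Lemma sep_corner A B C D : sep A B -> sep C D -> sep (A :&: C) (B :|: D).
Proof.
move=> sAB sCD; apply: sep_intro => [v|u v]; rewrite !inE => /andP [vA vC].
  by rewrite (sep_disj sAB vA) (sep_disj sCD vC).
by case/orP => [vB|vD]; rewrite ?(sep_noedge sAB vA vB) ?(sep_noedge sCD vC vD).
Qed.

Lemma card_corner A B C D :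
  sep A B -> sep C D ->
  #|cutset (A :&: C) (B :|: D)| =
  #|cutset A B :&: C| + #|cutset A B :&: cutset C D| + #|A :&: cutset C D|.
Proof.
move=> sAB sCD; rewrite (card_split _ sCD).
have -> : cutset (A :&: C) (B :|: D) :&: C = cutset A B :&: C.
  apply/setP => v; rewrite !inE; case vC: (v \in C); rewrite ?andbF //= !andbT.
  by rewrite (sep_disj sCD vC) orbF.
have -> : cutset (A :&: C) (B :|: D) :&: D = set0.
  by apply/setP => v; rewrite !inE; case: (v \in D); rewrite ?orbT ?andbF.
rewrite cards0 addn0 -addnA; congr (_ + _).
rewrite (card_split _ sAB); set W := cutset _ _ :&: _.
have -> : W :&: A = A :&: cutset C D.
  apply/setP => v; rewrite !inE; case vA: (v \in A); rewrite ?andbF // (sep_disj sAB vA).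
  by case: (v \in C); case: (v \in D).
have -> : W :&: cutset A B = cutset A B :&: cutset C D.
  by apply/setP => v; rewrite !inE; do 4!case: (_ \in _).
have -> : W :&: B = set0.
  by apply/setP => v; rewrite !inE; do 4!case: (_ \in _).
by rewrite cards0 addn0 addnC.
Qed.

Lemma card_corners A B C D (T := cutset A B) (S := cutset C D) :
  sep A B -> sep C D ->
  [/\ #|cutset (A :&: C) (B :|: D)| = #|T :&: C| + #|T :&: S| + #|A :&: S|,
      #|cutset (A :&: D) (B :|: C)| = #|T :&: D| + #|T :&: S| + #|A :&: S|,
      #|cutset (B :&: C) (A :|: D)| = #|T :&: C| + #|T :&: S| + #|B :&: S| &
      #|cutset (B :&: D) (A :|: C)| = #|T :&: D| + #|T :&: S| + #|B :&: S|].
Proof.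
move=> sAB sCD; have sBA : sep B A by rewrite sepC.
have sDC : sep D C by rewrite sepC.
by split; rewrite (card_corner _ _) // ?(cutsetC D C) ?(cutsetC B A).
Qed.

Lemma card_cells A B C D (T := cutset A B) (S := cutset C D) :
  sep A B -> sep C D ->
  [/\ #|A| = #|A :&: C| + #|A :&: S| + #|A :&: D|,
      #|B| = #|B :&: C| + #|B :&: S| + #|B :&: D| &
      #|T| = #|T :&: C| + #|T :&: S| + #|T :&: D|] /\
  [/\ #|C| = #|A :&: C| + #|T :&: C| + #|B :&: C|,
      #|D| = #|A :&: D| + #|T :&: D| + #|B :&: D| &
      #|S| = #|A :&: S| + #|T :&: S| + #|B :&: S|].
Proof.
move=> sAB sCD; split; split; try exact: card_split.
- by rewrite (card_split C sAB) !(setIC C).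
- by rewrite (card_split D sAB) !(setIC D).
- by rewrite (card_split S sAB) !(setIC S).
Qed.

Hypothesis qG : quasi5 G.
Hypothesis oG : 4 < #|G|.

Lemma fivesep_nbr A B z : fivesep A B -> z \in cutset A B -> exists2 a, a \in A & z -- a.
Proof.
case/and4P => sAB /eqP cT A1 B1 zT.
case: (boolP [exists a in A, z -- a]) => [/exists_inP [a aA za]|]; first by exists a.
rewrite negb_exists_in => /forall_inP noA; exfalso.
have sAz : sep A (z |: B).
  apply: sep_intro => [v vA|u v uA]; rewrite !inE.
    case/orP => [/eqP e|]; last by rewrite (sep_disj sAB vA).
    by move: zT; rewrite in_cutset -e vA.
  case/orP => [/eqP ->|vB]; last by rewrite (sep_noedge sAB uA vB).
  by rewrite sedge_sym; apply/negP; apply: noA.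
have /(_ A1) := qG.2 _ _ sAz; rewrite cardsU1.
have -> : cutset A (z |: B) = cutset A B :\ z.
  by apply/setP => v; rewrite !inE !negb_or andbCA.
rewrite in_cutset in zT; have := cardsD1 z (cutset A B).
by rewrite in_cutset zT cT; case/andP: zT => _ -> /=; move: #|_ :\ z| => n; clear -B1; lia.
Qed.

Definition isolated_four z : Prop :=
  forall m, m != z -> (z -- m) || [exists w, (z -- w) && (w -- m)] -> 4 < deg m.

Section Lonely.
Variable z : G.
Hypothesis nz : isolated_four z.

Lemma corner_at A B C D :
  fivesep A B -> fivesep C D -> z \in cutset A B -> z \in cutset C D ->
  A :&: C != set0 -> 4 < #|cutset (A :&: C) (B :|: D)|.
Proof.
move=> fAB fCD zT zS AC0; rewrite ltnNge; apply/negP => le4.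
have sX := sep_corner (fivesep_sep fAB) (fivesep_sep fCD).
have B1 : 1 < #|B :|: D|.
  by case/and4P: fAB => _ _ _ B1; apply: leq_trans B1 _; rewrite subset_leq_card ?subsetUl.
have [m [_ Nm dm]] := small_side qG oG sX AC0 B1 le4.
have mz : m -- z.
  have : z \in nbrs m; last by rewrite inE.
  by move: zT zS; rewrite Nm !in_cutset !inE => /andP [/negbTE -> /negbTE ->] /andP [_ /negbTE ->].
have /nz : m != z by apply: contraTneq mz => ->; rewrite sedge_irr.
by rewrite sedge_sym mz dm => /(_ isT).
Qed.

Lemma corner_off A B C D a :
  fivesep A B -> fivesep C D -> z \in cutset A B -> z \in cutset C D ->
  a \in A -> a \in cutset C D -> z -- a -> (forall v, v \in A -> z -- v -> v = a) ->
  A :&: C != set0 -> 5 < #|cutset (A :&: C) (B :|: D)|.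
Proof.
move=> fAB fCD zT zS aA aS za lone AC0; rewrite ltnNge; apply/negP => le5.
have sAB := fivesep_sep fAB; have sCD := fivesep_sep fCD.
have sX := sep_corner sAB sCD.
have sXz : sep (A :&: C) (z |: (B :|: D)).
  apply: sep_intro => [v vX|u v uX]; rewrite in_setU1.
    case/orP => [/eqP e|]; last by rewrite (sep_disj sX vX).
    by move: zT vX; rewrite in_cutset -e inE => /andP [/negbTE ->].
  case/orP => [/eqP ->|vB]; last by rewrite (sep_noedge sX uX vB).
  rewrite sedge_sym => zu; move: uX; rewrite inE => /andP [uA uC].
  by move: aS; rewrite -(lone _ uA zu) in_cutset uC.
have zX : z \in cutset (A :&: C) (B :|: D).
  by move: zT zS; rewrite !in_cutset !inE => /andP [/negbTE -> /negbTE ->] /andP [_ /negbTE ->].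
have e : cutset (A :&: C) (z |: (B :|: D)) = cutset (A :&: C) (B :|: D) :\ z.
  by apply/setP => v; rewrite !inE !negb_or; case: (v == z); rewrite ?andbF.
have B1 : 1 < #|z |: (B :|: D)|.
  case/and4P: fAB => _ _ _ B1; apply: leq_trans B1 _; apply: subset_leq_card.
  by apply/subsetP => v vB; rewrite !inE vB orbT.
have le4 : #|cutset (A :&: C) (z |: (B :|: D))| <= 4.
  by move: (cardsD1 z (cutset (A :&: C) (B :|: D))) le5; rewrite e zX => ->.
have [m [AC Nm dm]] := small_side qG oG sXz AC0 B1 le4.
have mA : m \in A by have := set11 m; rewrite -AC inE => /andP [].
have ma : m -- a.
  have : a \in nbrs m; last by rewrite inE.
  have az : a != z by apply: contraTneq za => ->; rewrite sedge_irr.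
  move: aS; rewrite Nm e in_setD1 az !in_cutset !inE aA => /andP [/negbTE -> /negbTE ->].
  by rewrite (sep_disj sAB aA).
have /nz : m != z by apply: contraTneq zT => <-; rewrite in_cutset mA.
suff -> : (z -- m) || [exists w, (z -- w) && (w -- m)] by rewrite dm => /(_ isT).
by apply/orP; right; apply/existsP; exists a; rewrite za sedge_sym ma.
Qed.

(* Every nonempty corner of [A] misses the neighbours of [z], so its bounding set, from
   which [z] may be dropped, has at least six elements; the opposite corner is then empty. *)
Lemma lonely_cells A B C D a :
  fivesep A B -> fivesep C D -> z \in cutset A B -> z \in cutset C D ->
  a \in A -> a \in cutset C D -> z -- a -> (forall v, v \in A -> z -- v -> v = a) ->
  [/\ #|A| = 2, A \subset cutset C D, cutset A B :&: cutset C D = [set z],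
      #|cutset A B :&: C| = 2 & #|cutset A B :&: D| = 2].
Proof.
move=> fAB fCD zT zS aA aS za lone.
have [fBA fDC] : fivesep B A /\ fivesep D C by rewrite fivesepC fAB fivesepC fCD.
have zT' : z \in cutset B A by rewrite cutsetC.
have [zS' aS'] : z \in cutset D C /\ a \in cutset D C by rewrite cutsetC.
have hAC := corner_off fAB fCD zT zS aA aS za lone.
have hAD := corner_off fAB fDC zT zS' aA aS' za lone.
have hBC := corner_at fBA fCD zT' zS.
have hBD := corner_at fBA fDC zT' zS'.
have [eAC eAD eBC eBD] := card_corners (fivesep_sep fAB) (fivesep_sep fCD).
have [[eA eB eT] [eC eD eS]] := card_cells (fivesep_sep fAB) (fivesep_sep fCD).
have cT := fivesep_card fAB; have cS := fivesep_card fCD.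
case/and4P: fAB => _ _ A1 B1; case/and4P: fCD => _ _ C1 D1.
rewrite -!card_gt0 in hAC hAD hBC hBD.
have aAS : 0 < #|A :&: cutset C D| by apply/card_gt0P; exists a; rewrite inE aA.
have zTS : z \in cutset A B :&: cutset C D by rewrite inE zT.
have zTS0 : 0 < #|cutset A B :&: cutset C D| by apply/card_gt0P; exists z.
have [[AC0 AD0 cA] [TC TD TS]] : [/\ #|A :&: C| = 0, #|A :&: D| = 0 & #|A| = 2] /\
    [/\ #|cutset A B :&: C| = 2, #|cutset A B :&: D| = 2 & #|cutset A B :&: cutset C D| = 1].
  clear -hAC hAD hBC hBD eAC eAD eBC eBD eA eB eT eC eD eS cT cS A1 B1 C1 D1 aAS zTS0.
  by split; split; lia.
split=> //.
  apply/subsetP => v vA; rewrite in_cutset; apply/andP; split; apply/negP => vC.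
    by move/eqP: AC0; rewrite cards_eq0 => /eqP/setP/(_ v); rewrite !inE vA vC.
  by move/eqP: AD0; rewrite cards_eq0 => /eqP/setP/(_ v); rewrite !inE vA vC.
by move/eqP/cards1P: TS => [t e]; move: zTS; rewrite e inE => /eqP ->.
Qed.

End Lonely.
End Crossing.

(* The two obstructions to contracting [x -- y]: a common neighbour of degree four would get
   degree three, and a nontrivial 5-cut through [x] and [y] would become a nontrivial 4-cut. *)
Definition blocked (G : sgraph) (x y : G) : bool :=
  [exists z, [&& z -- x, z -- y & deg z == 4]] ||
  [exists A : {set G}, exists B : {set G},
     [&& fivesep A B, x \in cutset A B & y \in cutset A B]].

Section Pairs.
Variable G : sgraph.
Implicit Types (A B C D T X : {set G}) (u v w z p q : G).
Hypothesis qG : quasi5 G.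
Hypothesis oG : 4 < #|G|.
Hypothesis blockedG : forall x y : G, x -- y -> blocked x y.

Lemma cutset_at_edge z v :
  isolated_four z -> z -- v ->
  exists C D, [/\ fivesep C D, z \in cutset C D & v \in cutset C D].
Proof.
move=> nz zv; case/orP: (blockedG zv) => [/existsP [w /and3P [wz wv /eqP dw]]|].
  have /nz : w != z by apply: contraTneq wz => ->; rewrite sedge_irr.
  by rewrite sedge_sym wz dw => /(_ isT).
by case/existsP => C /existsP [D /and3P [fCD zS vS]]; exists C, D.
Qed.

Lemma lonely_card z A B a :
  isolated_four z -> fivesep A B -> z \in cutset A B -> a \in A -> z -- a ->
  (forall v, v \in A -> z -- v -> v = a) -> #|A| = 2.
Proof.
move=> nz fAB zT aA za lone; have [C [D [fCD zS aS]]] := cutset_at_edge nz za.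
by have [] := lonely_cells qG oG nz fAB fCD zT zS aA aS za lone.
Qed.

Lemma lonely_mate z A B a :
  fivesep A B -> z \in cutset A B -> a \in A -> z -- a ->
  (forall v, v \in A -> z -- v -> v = a) -> #|A| = 2 ->
  exists a', [/\ A = [set a; a'], a' != a, (z -- a') = false &
    4 < deg a' -> forall w, (a' -- w) = (w == a) || (w \in cutset A B) && (w != z)].
Proof.
move=> fAB zT aA za lone /eqP/cards2P [x [y [xy defA]]].
have [a' [aa' eA]] : exists a', a' != a /\ A = [set a; a'].
  move: aA; rewrite defA !inE => /orP [] /eqP ->; [exists y|exists x]; first by rewrite eq_sym.
  by rewrite setUC.
have a'A : a' \in A by rewrite eA !inE eqxx orbT.
have za' : (z -- a') = false by apply/negP => /(lone _ a'A) e; rewrite e eqxx in aa'.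
exists a'; split=> // d5.
have sub : nbrs a' \subset a |: (cutset A B :\ z).
  apply/subsetP => w; rewrite inE => a'w; rewrite in_setU1 in_setD1 in_cutset.
  case: (eqVneq w a) => //= wa; apply/and3P; split.
  - by apply: contraFneq za' => <-; rewrite sedge_sym.
  - by rewrite eA !inE negb_or wa; apply: contraTneq a'w => ->; rewrite sedge_irr.
  - by apply: contraTN a'w => wB; rewrite (sep_noedge (fivesep_sep fAB) a'A wB).
have le : #|a |: (cutset A B :\ z)| <= 5.
  rewrite cardsU1; have := cardsD1 z (cutset A B); rewrite zT (fivesep_card fAB).
  by case: (a \notin _) => /=; clear; lia.
have e : nbrs a' = a |: (cutset A B :\ z).
  by apply/eqP; rewrite eqEcard sub /=; apply: leq_trans le _; exact: d5.
by move=> w; move/setP/(_ w): e; rewrite in_setU1 in_setD1 inE => ->; rewrite (andbC (w != z)).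
Qed.

End Pairs.

(** * Minimum degree five *)

Section FiveConnected.
Variable G : sgraph.
Implicit Types (A B C D T X : {set G}) (u v w z p q t : G).
Hypothesis qG : quasi5 G.
Hypothesis oG : 4 < #|G|.
Hypothesis blockedG : forall x y : G, x -- y -> blocked x y.
Hypothesis deg5 : forall v : G, 4 < deg v.

Lemma isolated_deg5 z : isolated_four z.
Proof. by move=> m _ _. Qed.

Lemma cutset_ge5 A B : sep A B -> A != set0 -> B != set0 -> 4 < #|cutset A B|.
Proof.
move=> sAB A0 B0; rewrite ltnNge; apply/negP => le4.
case: (ltnP 1 #|B|) => [B1|B1].
  by have [m [_ _ dm]] := small_side qG oG sAB A0 B1 le4; have := deg5 m; rewrite dm.
have /cards1P [m Bm] : #|B| == 1 by rewrite eqn_leq B1 card_gt0.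
have sBA : sep B A by rewrite sepC.
have [|_ dm] := nbrs_eq_cutset qG oG sBA Bm; first by rewrite cutsetC.
by have := deg5 m; rewrite dm.
Qed.

Lemma edge_cutset u v :
  u -- v -> exists C D, [/\ fivesep C D, u \in cutset C D & v \in cutset C D].
Proof. exact/cutset_at_edge/isolated_deg5. Qed.

Lemma sum_nbrs A B : \sum_(u in A) #|nbrs u :&: B| = \sum_(v in B) #|nbrs v :&: A|.
Proof.
have e X Y : \sum_(u in X) #|nbrs u :&: Y| = \sum_(u in X) \sum_(v in Y) (u -- v).
  apply: eq_bigr => u _; rewrite -sum1_card big_mkcond [RHS]big_mkcond /=; apply: eq_bigr => v _; rewrite !inE.
  by case: (v \in Y); case: (u -- v).
rewrite !e exchange_big /=; apply: eq_bigr => u _; apply: eq_bigr => v _.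
by rewrite sedge_sym.
Qed.

Definition edgesep A B : bool :=
  fivesep A B && [exists u in cutset A B, exists v in cutset A B, u -- v].

Lemma edgesepI A B u v :
  fivesep A B -> u \in cutset A B -> v \in cutset A B -> u -- v -> edgesep A B.
Proof.
move=> fAB uT vT uv; rewrite /edgesep fAB; apply/exists_inP; exists u => //.
by apply/exists_inP; exists v.
Qed.

Section Minimal.
Variables A B : {set G}.
Hypothesis eAB : edgesep A B.
Hypothesis minA : forall C D, edgesep C D -> #|A| <= #|C|.
Hypothesis A3 : 2 < #|A|.

Let fAB : fivesep A B. Proof. by case/andP: eAB. Qed.

(* Uncrossing with a five-element cut through [a] and [a']: a corner of [A] with two
   elements needs a cutset of size six, as its cutset contains [a] and [a']. *)
Lemma minimal_cells C D a a' :
  fivesep C D -> a \in A -> a' \in A -> a -- a' -> a \in cutset C D -> a' \in cutset C D ->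
  [/\ #|A :&: cutset C D| = 2, #|A :&: D| <= 1, #|A :&: C| <= 1 &
      #|A :&: C| = 1 -> #|cutset (A :&: C) (B :|: D)| = 5].
Proof.
move=> fCD aA a'A aa' aS a'S.
have sAB := fivesep_sep fAB; have sCD := fivesep_sep fCD.
have [sBA sDC] : sep B A /\ sep D C by rewrite sepC sAB sepC sCD.
have big E F : fivesep E F -> a \in cutset E F -> a' \in cutset E F ->
    1 < #|A :&: E| -> 5 != #|cutset (A :&: E) (B :|: F)|.
  move=> fEF aS1 a'S1 AE1; apply/negP => /eqP c5.
  have sX := sep_corner sAB (fivesep_sep fEF).
  have fX : fivesep (A :&: E) (B :|: F).
    rewrite /fivesep sX -c5 AE1; case/and4P: fAB => _ _ _ B1.
    by rewrite (leq_trans B1) // subset_leq_card // subsetUl.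
  have inX v : v \in A -> v \in cutset E F -> v \in cutset (A :&: E) (B :|: F).
    rewrite !in_cutset !inE => vA /andP [/negbTE -> /negbTE ->].
    by rewrite andbF (sep_disj sAB vA).
  have := minA (edgesepI fX (inX _ aA aS1) (inX _ a'A a'S1) aa').
  rewrite leqNgt => /negP; apply; apply: proper_card; apply/properP; split; first exact: subsetIl.
  by exists a => //; rewrite inE aA; move: aS1; rewrite in_cutset => /andP [].
have ge5 E F X Y : sep E F -> sep X Y -> E :&: X != set0 -> 1 < #|F| ->
    4 < #|cutset (E :&: X) (F :|: Y)|.
  move=> s1 s2 n0 F1; apply: cutset_ge5 => //; first exact: sep_corner.
  by rewrite -card_gt0 (leq_trans (ltnW F1)) // subset_leq_card // subsetUl.
have fDC : fivesep D C by rewrite fivesepC.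
have [aS' a'S'] : a \in cutset D C /\ a' \in cutset D C by rewrite cutsetC.
case/and4P: (fAB) => _ _ A1 B1; case/and4P: (fCD) => _ _ C1 D1.
have hC := big C D fCD aS a'S; have hD := big D C fDC aS' a'S'.
have hAC := ge5 A B C D sAB sCD; have hAD := ge5 A B D C sAB sDC.
have hBC := ge5 B A C D sBA sCD; have hBD := ge5 B A D C sBA sDC.
rewrite -!card_gt0 in hAC hAD hBC hBD.
have mC := minA (edgesepI fCD aS a'S aa'); have mD := minA (edgesepI fDC aS' a'S' aa').
have [eAC eAD eBC eBD] := card_corners sAB sCD.
have [[eA eB eT] [eC eD eS]] := card_cells sAB sCD.
have cT := fivesep_card fAB; have cS := fivesep_card fCD.
have aneq : a != a' by apply: contraTneq aa' => ->; rewrite sedge_irr.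
have AS2 : 1 < #|A :&: cutset C D|.
  have <- : #|[set a; a']| = 2 by rewrite cards2 aneq.
  by apply: subset_leq_card; apply/subsetP => v; rewrite in_setI in_set2 => /orP [] /eqP ->;
    rewrite ?aA ?a'A.
clear -hC hD hAC hAD hBC hBD mC mD eAC eAD eBC eBD eA eB eT eC eD eS cT cS A1 B1 C1 D1 AS2 A3.
by split; lia.
Qed.

Lemma minimal_nbrs a a' c :
  a \in A -> a' \in A -> a -- a' -> c \in A -> c != a -> c != a' ->
  [/\ c -- a, c -- a', deg c = 5 &
      forall d, d \in A -> d != a -> d != a' -> c -- d = false].
Proof.
move=> aA a'A aa' cA ca ca'.
have [C [D [fCD aS a'S]]] := edge_cutset aa'.
have [C' [D' [{aS a'S}fCD aS a'S cC]]] :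
    exists C D, [/\ fivesep C D, a \in cutset C D, a' \in cutset C D & c \in C].
  have := minimal_cells fCD aA a'A aa' aS a'S; case=> AS2 _ _ _.
  have eAS : A :&: cutset C D = [set a; a'].
    apply/esym/eqP; rewrite eqEcard AS2 cards2 (_ : a != a') ?andbT; last first.
      by apply: contraTneq aa' => ->; rewrite sedge_irr.
    by apply/subsetP => v; rewrite in_setI in_set2 => /orP [] /eqP ->; rewrite ?aA ?a'A.
  have : c \notin A :&: cutset C D by rewrite eAS !inE negb_or ca ca'.
  rewrite in_setI cA /= in_cutset negb_and !negbK => /orP [cC|cD]; first by exists C, D.
  by exists D, C; rewrite fivesepC cutsetC.
have sAB := fivesep_sep fAB; have sCD := fivesep_sep fCD.
have [AS2 AD1 AC1 AC5] := minimal_cells fCD aA a'A aa' aS a'S.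
have cAC : c \in A :&: C' by rewrite inE cA.
have eAC : A :&: C' = [set c].
  apply/esym/eqP; rewrite eqEcard cards1 AC1 andbT; apply/subsetP => v.
  by rewrite inE => /eqP ->.
have {AC5}c5 : #|cutset (A :&: C') (B :|: D')| = 5 by apply: AC5; rewrite eAC cards1.
have Nc : nbrs c = cutset (A :&: C') (B :|: D').
  by apply/eqP; rewrite eqEcard (nbrs_cutset (sep_corner sAB sCD) eAC) c5; apply: deg5.
have inX v : v \in A -> v \in cutset C' D' -> c -- v.
  move=> vA vS; have : v \in nbrs c; last by rewrite inE.
  rewrite Nc; move: vS; rewrite !in_cutset !inE => /andP [/negbTE -> /negbTE ->].
  by rewrite andbF (sep_disj sAB vA).
split; [exact: inX|exact: inX|by rewrite /deg -/(nbrs c) Nc|].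
move=> d dA da da'; apply/negP => cd.
have : d \in nbrs c by rewrite inE.
rewrite Nc in_cutset !inE dA /= negb_or => /and3P [dC _ dD].
have dS : d \in cutset C' D' by rewrite in_cutset dC.
have : 2 < #|A :&: cutset C' D'|; last by rewrite AS2.
have <- : #|[set a; a'; d]| = 3.
  rewrite setUC cardsU1 !inE negb_or da da' cards2 (_ : a != a') //.
  by apply: contraTneq aa' => ->; rewrite sedge_irr.
apply: subset_leq_card; apply/subsetP => v; rewrite in_setI in_setU in_set2 in_set1 -orbA.
by case/or3P => /eqP ->; rewrite ?aA ?a'A ?dA.
Qed.

Lemma minimal_absurd : False.
Proof.
have sAB := fivesep_sep fAB.
have [a [a' [aA a'A aa']]] : exists a a', [/\ a \in A, a' \in A & a -- a'].
  case: (boolP [exists a in A, exists a' in A, a -- a']).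
    by case/exists_inP => a aA /exists_inP [a' a'A aa']; exists a, a'.
  rewrite negb_exists_in => /forall_inP none; exfalso.
  have noA u v : u \in A -> v \in A -> u -- v = false.
    move=> uA vA; apply/negP => uv; have := none u uA; rewrite negb_exists_in.
    by move/forall_inP/(_ v vA); rewrite uv.
  have /card_gt1P [a [a' [aA a'A aa']]] : 1 < #|A| by apply: ltnW.
  pose X := [set a; a']; have XA : X \subset A.
    by apply/subsetP => v; rewrite !inE => /orP [] /eqP ->.
  pose Y := ~: (X :|: cutset A B).
  have cXY : cutset X Y = cutset A B.
    apply/setP => v; rewrite in_cutset /Y in_setC negbK in_setU.
    case vX: (v \in X) => //=; rewrite in_cutset.
    by rewrite (subsetP XA _ vX).
  have fXY : fivesep X Y.
    rewrite /fivesep cXY (fivesep_card fAB) cards2 aa' /=; apply/andP; split.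
      apply: sep_intro => [v vX|u v uX]; rewrite /Y in_setC in_setU ?vX // negb_or.
      case/andP => vX; rewrite in_cutset negb_and !negbK => /orP [vA|vB].
        by rewrite noA // (subsetP XA).
      by rewrite (sep_noedge sAB (subsetP XA _ uX) vB).
    case/and4P: fAB => _ _ _ B1; apply: leq_trans B1 _; apply: subset_leq_card.
    apply/subsetP => v vB; rewrite /Y in_setC in_setU negb_or in_cutset vB andbF andbT.
    by apply: contraL vB => /(subsetP XA) vA; rewrite (sep_disj sAB vA).
  have eXY : edgesep X Y by move: eAB; rewrite /edgesep fXY cXY fAB.
  by have := minA eXY; rewrite cards2 aa'; move: A3; clear; lia.
have aneq : a != a' by apply: contraTneq aa' => ->; rewrite sedge_irr.
have [c cA /andP [ca ca']] : exists2 c, c \in A & (c != a) && (c != a').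
  case: (boolP [exists c in A, (c != a) && (c != a')]) => [/exists_inP //|].
  rewrite negb_exists_in => /forall_inP none; exfalso.
  have : #|A| <= #|[set a; a']|; last by rewrite cards2; move: A3; clear; lia.
  apply: subset_leq_card; apply/subsetP => v /none; rewrite negb_and !negbK !inE.
  by [].
have [ca1 ca'1 dc noc] := minimal_nbrs aA a'A aa' cA ca ca'.
have defA v : v \in A -> [|| v == a, v == a' | v == c].
  move=> vA; case: (eqVneq v a) => //= va; case: (eqVneq v a') => //= va'.
  apply/negP => /negP vc.
  have [_ va'1 _ _] := minimal_nbrs aA a'A aa' vA va va'.
  have ac : a -- c by rewrite sedge_sym.
  have [_ _ _ nov] := minimal_nbrs aA cA ac vA va vc.
  by have := nov a' a'A; rewrite va'1 !(eq_sym a') ca' (negbTE aneq) /= => /(_ isT isT).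
have a'a : a' != a by rewrite eq_sym.
have [ac a'c] : a != c /\ a' != c by rewrite !(eq_sym _ c).
have da' : deg a' = 5.
  by have [] : [/\ a' -- a, a' -- c, deg a' = 5 & _] := minimal_nbrs aA cA (etrans (sedge_sym a c) ca1) a'A a'a a'c.
have da : deg a = 5.
  by have [] := minimal_nbrs a'A cA (etrans (sedge_sym a' c) ca'1) aA aneq ac.
have cA3 : A = [set a; a'; c].
  apply/setP => v; rewrite !inE -orbA; apply/idP/idP; first exact: defA.
  by case/or3P => /eqP ->.
have few v : v \in A -> #|nbrs v :&: cutset A B| <= 3.
  move=> vA; have := card_split (nbrs v) sAB.
  have -> : #|nbrs v| = 5 by rewrite -[#|_|]/(deg v); case/or3P: (defA _ vA) => /eqP ->.
  have : 1 < #|nbrs v :&: A|; last by clear; lia.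
  have three x y : x != y -> x \in A -> y \in A -> v -- x -> v -- y -> 1 < #|nbrs v :&: A|.
    by move=> xy xA yA vx vy; apply/card_gt1P; exists x, y; rewrite !inE xA yA vx vy.
  case/or3P: (defA _ vA) => /eqP e; rewrite e in three *.
  - by apply: (three a' c) => //; rewrite 1?eq_sym // sedge_sym.
  - by apply: (three a c); rewrite // 1?eq_sym // sedge_sym.
  - by apply: (three a a').
have many t : t \in cutset A B -> 1 < #|nbrs t :&: A|.
  move=> tT; have [v vA tv] := fivesep_nbr qG fAB tT.
  rewrite ltnNge; apply/negP => le1.
  have : #|A| = 2; last by move: A3; clear; lia.
  apply: (lonely_card qG oG blockedG (isolated_deg5 (z:=t)) fAB tT vA tv) => w wA tw.
  by move/card_le1_eqP: le1; apply; rewrite !inE ?wA ?vA ?tv ?tw.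
have := sum_nbrs A (cutset A B).
have le9 : \sum_(u in A) #|nbrs u :&: cutset A B| <= 9.
  apply: leq_trans (_ : \sum_(u in A) 3 <= _); first exact: leq_sum.
  rewrite sum_nat_const cA3 setUC cardsU1 cards2.
  by case: (_ \notin _); case: (_ == _).
have ge10 : 10 <= \sum_(v in cutset A B) #|nbrs v :&: A|.
  apply: leq_trans (_ : \sum_(v in cutset A B) 2 <= _); last exact: leq_sum.
  by rewrite sum_nat_const (fivesep_card fAB).
by move=> e; move: le9 ge10; rewrite e; clear; lia.
Qed.

End Minimal.

Lemma edgesep_pair :
  exists p q B, [/\ p != q, fivesep [set p; q] B & edgesep [set p; q] B].
Proof.
have [A0 [B0 e0]] : exists A B, edgesep A B.
  have /card_gt0P [u _] : 0 < #|G| by apply: ltn_trans oG.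
  have /card_gt0P [v] : 0 < #|nbrs u| by apply: ltn_trans (deg5 u).
  rewrite inE => uv; have [C [D [fCD uS vS]]] := edge_cutset uv.
  by exists C, D; apply: edgesepI uv.
pose P := [pred X : {set G} * {set G} | edgesep X.1 X.2].
have P0 : P (A0, B0) by [].
case: (arg_minnP (fun X : {set G} * {set G} => #|X.1|) P0) => -[A B] /= eAB minA.
have min C D : edgesep C D -> #|A| <= #|C| by move=> eCD; apply: (minA (C, D)).
case: (ltnP 2 #|A|) => [A3|A2]; first by case: (minimal_absurd eAB min A3).
have [fAB _] := andP eAB.
have /cards2P [p [q [pq defA]]] : #|A| == 2 by rewrite eqn_leq A2; case/and4P: fAB.
by exists p, q, B; rewrite -defA.
Qed.

End FiveConnected.

Section PairSeparations.
Variable G : sgraph.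
Implicit Types (A B C D T X : {set G}) (u v w z p q t : G).
Hypothesis qG : quasi5 G.
Hypothesis oG : 4 < #|G|.
Hypothesis blockedG : forall x y : G, x -- y -> blocked x y.
Hypothesis deg5 : forall v : G, 4 < deg v.

Let iso z : isolated_four z. Proof. exact: isolated_deg5. Qed.

Definition pairsep p q B := (p != q) && fivesep [set p; q] B.

Lemma pairsepC p q B : pairsep p q B = pairsep q p B.
Proof. by rewrite /pairsep eq_sym setUC. Qed.

Lemma pairsep_nbr p q B u :
  pairsep p q B -> u \in cutset [set p; q] B -> (u -- p) || (u -- q).
Proof.
case/andP => _ f uT; have [v] := fivesep_nbr qG f uT.
by rewrite !inE => /orP [] /eqP -> ->; rewrite ?orbT.
Qed.

Lemma pairsep_cut p q B C D t :
  pairsep p q B -> fivesep C D -> p \in cutset C D -> q \in cutset C D ->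
  t \in cutset [set p; q] B -> t \in cutset C D ->
  [/\ #|cutset [set p; q] B :&: C| = 2, #|cutset [set p; q] B :&: D| = 2 &
      forall w, w \in cutset [set p; q] B -> w != t -> (w \in C) || (w \in D)].
Proof.
case/andP => pq fAB fCD pS qS tT tS; set A := [set p; q] in fAB tT *.
have sAB := fivesep_sep fAB; have sCD := fivesep_sep fCD.
have [sBA sDC] : sep B A /\ sep D C by rewrite sepC sAB sepC sCD.
have AS : A :&: cutset C D = A.
  by apply/setIidPl/subsetP => v; rewrite !in_set2 => /orP [] /eqP ->.
have cA : #|A| = 2 by rewrite cards2 pq.
have ge5 X Y : sep X Y -> B :&: X != set0 -> 4 < #|cutset (B :&: X) (A :|: Y)|.
  move=> s2 n0; apply: cutset_ge5 => //; first exact: sep_corner.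
  by apply/set0Pn; exists p; rewrite !inE eqxx.
have hBC := ge5 C D sCD; have hBD := ge5 D C sDC.
rewrite -!card_gt0 in hBC hBD.
have [eAC eAD eBC eBD] := card_corners sAB sCD.
have [[eA eB eT] [eC eD eS]] := card_cells sAB sCD.
have cT := fivesep_card fAB; have cS := fivesep_card fCD.
case/and4P: (fCD) => _ _ C1 D1.
have tTS : t \in cutset A B :&: cutset C D by rewrite inE tT.
have TS0 : 0 < #|cutset A B :&: cutset C D| by apply/card_gt0P; exists t.
have cAS : #|A :&: cutset C D| = 2 by rewrite AS.
have [TC TD /eqP/cards1P [t' TS]] : [/\ #|cutset A B :&: C| = 2,
    #|cutset A B :&: D| = 2 & #|cutset A B :&: cutset C D| = 1].
  clear -hBC hBD eA eBC eBD eB eT eC eD eS cT cS C1 D1 TS0 cA cAS.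
  by split; lia.
split=> // w wT wt; rewrite -[_ || _]negbK negb_or -in_cutset; apply: contra wt => wS.
have : w \in cutset A B :&: cutset C D by rewrite inE wT.
by move: tTS; rewrite TS !inE => /eqP -> /eqP ->.
Qed.

Lemma other_of_two X u : #|X| = 2 -> u \in X -> exists2 i, i != u & X = [set i; u].
Proof.
move=> /eqP/cards2P [x [y [xy ->]]]; rewrite !inE => /orP [] /eqP ->.
  by exists y; [rewrite eq_sym | rewrite setUC].
by exists x.
Qed.

Lemma pairsep_nbr_in p q B w :
  pairsep p q B -> p -- w -> w != q -> w \in cutset [set p; q] B.
Proof.
case/andP => _ f pw wq; have pA : p \in [set p; q] by rewrite !inE eqxx.
rewrite in_cutset !inE negb_or wq andbT (sep_nbr (fivesep_sep f) pA pw) andbT.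
by apply: contraTneq pw => ->; rewrite sedge_irr.
Qed.

Lemma pairsep_lone_side p q B C D u' :
  pairsep p q B -> fivesep C D -> p \in cutset C D -> q \in cutset C D ->
  #|cutset [set p; q] B :&: C| = 2 -> u' \in cutset [set p; q] B -> u' \in C ->
  p -- u' = false ->
  exists i, [/\ C = [set i; u'], i != u', i \in cutset [set p; q] B &
    forall w, (u' -- w) = (w == i) || (w \in cutset C D) && (w != p)].
Proof.
move=> pP f pS qS TC u'T u'C pu'.
have [|i iu' eTC] := other_of_two TC (u := u'); first by rewrite inE u'T.
have /andP [iT iC] : (i \in cutset [set p; q] B) && (i \in C).
  by rewrite -in_setI eTC !inE eqxx.
have lonei : forall v, v \in C -> p -- v -> v = i.
  move=> v vC pv; have : v \in cutset [set p; q] B :&: C.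
    rewrite inE vC (pairsep_nbr_in pP) //; apply: contraTneq vC => ->.
    by move: qS; rewrite in_cutset => /andP [].
  by rewrite eTC !inE => /orP [] /eqP // e; rewrite e pu' in pv.
have [v vC pv] := fivesep_nbr qG f pS.
have pi : p -- i by rewrite -(lonei v vC pv).
have c2 := lonely_card qG oG blockedG (@iso p) f pS iC pi lonei.
have [a' [eC _ _ /(_ (deg5 a')) N]] := lonely_mate f pS iC pi lonei c2.
have ea' : a' = u'.
  by move: u'C; rewrite eC !inE eq_sym (negbTE iu') /= => /eqP.
by exists i; rewrite -ea'; split=> //; rewrite ea'.
Qed.

Lemma half_miss p q B u u' :
  pairsep p q B -> u \in cutset [set p; q] B -> u' \in cutset [set p; q] B ->
  q -- u = false -> p -- u' = false ->
  exists C D i, [/\ fivesep C D, p \in cutset C D /\ q \in cutset C D, u \in cutset C D,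
     C = [set i; u'] & i != u'] /\
    [/\ i \in cutset [set p; q] B, i != u,
     forall w, (u' -- w) = (w == i) || (w \in cutset C D) && (w != p) &
     forall w, w \in cutset [set p; q] B -> w \notin [:: u; u'; i] -> w \in D].
Proof.
move=> pP uT u'T qu pu'; have /andP [pq fAB] := pP.
have up : u -- p by have := pairsep_nbr pP uT; rewrite (sedge_sym u q) qu orbF.
have [C0 [D0 [f0 uS0 pS0]]] := edge_cutset blockedG deg5 up.
have pA : p \in [set p; q] by rewrite !inE eqxx.
have qA : q \in [set p; q] by rewrite !inE eqxx orbT.
have lone : forall v, v \in [set p; q] -> u -- v -> v = p.
  by move=> v; rewrite !inE => /orP [] /eqP -> //; rewrite sedge_sym qu.
have [_ AS _ _ _] := lonely_cells qG oG (@iso u) fAB f0 uT uS0 pA pS0 up lone.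
have qS0 : q \in cutset C0 D0 by apply: (subsetP AS).
have [_ _ TCD] := pairsep_cut pP f0 pS0 qS0 uT uS0.
have u'u : u' != u by apply: contraFneq pu' => ->; rewrite sedge_sym.
have [C [D [f eS u'C]]] := fivesep_orient f0 (TCD _ u'T u'u).
rewrite -eS in uS0 pS0 qS0; have [TC TD {}TCD] := pairsep_cut pP f pS0 qS0 uT uS0.
have [i [eC iu' iT N]] := pairsep_lone_side pP f pS0 qS0 TC u'T u'C pu'.
have iu : i != u.
  apply: contraTneq uS0 => <-; rewrite in_cutset negb_and eC.
  by rewrite !inE eqxx.
exists C, D, i; split; split=> // w wT; rewrite !inE !negb_or.
case/and3P => wu wu' wi; have := TCD w wT wu; rewrite eC !inE (negbTE wi).
by rewrite (negbTE wu').
Qed.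

Lemma card_fivesep A B : fivesep A B -> #|G| = #|A| + 5 + #|B|.
Proof.
move=> f; rewrite -(fivesep_card f) -cardsT (card_split setT (fivesep_sep f)).
by rewrite !setTI.
Qed.

End PairSeparations.

Section PairMissSame.
Variable G : sgraph.
Implicit Types (A B C D E F T X : {set G}) (u v w z p q t : G).
Hypothesis qG : quasi5 G.
Hypothesis oG : 4 < #|G|.
Hypothesis blockedG : forall x y : G, x -- y -> blocked x y.
Hypothesis deg5 : forall v : G, 4 < deg v.

Let iso z : isolated_four z. Proof. exact: isolated_deg5. Qed.

Lemma miss_nbrs p q B u :
  pairsep p q B -> u \in cutset [set p; q] B -> q -- u = false ->
  forall w, (q -- w) = (w == p) || (w \in cutset [set p; q] B) && (w != u).
Proof.
move=> pP uT qu; have /andP [pq fAB] := pP.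
have pA : p \in [set p; q] by rewrite !inE eqxx.
have up : u -- p by have := pairsep_nbr qG pP uT; rewrite (sedge_sym u q) qu orbF.
have lone : forall v, v \in [set p; q] -> u -- v -> v = p.
  by move=> v; rewrite !inE => /orP [] /eqP -> //; rewrite sedge_sym qu.
have [|a' [eA ap _ /(_ (deg5 a')) N]] := lonely_mate fAB uT pA up lone.
  by rewrite cards2 pq.
have : a' \in [set p; q] by rewrite eA !inE eqxx orbT.
by rewrite !inE (negbTE ap) /= => /eqP e w; rewrite -N e.
Qed.

(* The neighbours of [i] other than the vertex [b] chosen below form a 4-cycle, so a cut through
   [i] and [b] leaves a single one on each side, and [G] would have only nine vertices. *)
Lemma miss_same p q B u u' C D C' D' i :
  pairsep p q B -> u \in cutset [set p; q] B -> u' \in cutset [set p; q] B ->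
  u != u' -> p -- q ->
  fivesep C D -> p \in cutset C D -> q \in cutset C D -> u \in cutset C D ->
  C = [set i; u'] -> i != u' -> i != u -> i \in cutset [set p; q] B ->
  (forall w, (u' -- w) = (w == i) || (w \in cutset C D) && (w != p)) ->
  (forall w, w \in cutset [set p; q] B -> w \notin [:: u; u'; i] -> w \in D) ->
  fivesep C' D' -> p \in cutset C' D' -> q \in cutset C' D' -> u' \in cutset C' D' ->
  C' = [set i; u] ->
  (forall w, (u -- w) = (w == i) || (w \in cutset C' D') && (w != q)) ->
  (forall w, w \in cutset [set p; q] B -> w \notin [:: u'; u; i] -> w \in D') -> False.
Proof.
move=> pP uT u'T uu' pq f pS qS uS eC iu' iu iT Nu' restD f' pS' qS' u'S' eC' Nu restD'.
have /andP [npq fAB] := pP.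
have iC : i \in C by rewrite eC !inE eqxx.
have u'C : u' \in C by rewrite eC !inE eqxx orbT.
have iC' : i \in C' by rewrite eC' !inE eqxx.
have uC' : u \in C' by rewrite eC' !inE eqxx orbT.
have sCD := fivesep_sep f; have sCD' := fivesep_sep f'.
have inS X Y w : sep X Y -> i \in X -> i -- w -> w \notin X -> w \in cutset X Y.
  by move=> s iX iw wX; rewrite in_cutset wX (sep_nbr s iX iw).
have Ni w : i -- w -> w \notin [:: u; u'; p; q] -> w \in cutset C D /\ w \in cutset C' D'.
  move=> iw wl; rewrite !inE !negb_or in wl; case/and4P: wl => wu wu' _ _.
  have wi : w != i by apply: contraTneq iw => ->; rewrite sedge_irr.
  split; [apply: (inS C D w sCD iC iw)|apply: (inS C' D' w sCD' iC' iw)];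
    by rewrite ?eC ?eC' !inE negb_or wi.
have [b ib bl] : exists2 b, i -- b & b \notin [:: u; u'; p; q].
  have : ~~ (nbrs i \subset [set x in [:: u; u'; p; q]]).
    apply: contraL (deg5 i) => /subset_leq_card; rewrite -[#|nbrs i|]/(deg i) -leqNgt => /leq_trans; apply.
    by rewrite cardsE; apply: leq_trans (card_size _) _.
  by case/subsetPn => b; rewrite !inE => ib bl; exists b; rewrite // !inE.
have [bS bS'] := Ni b ib bl.
move: bl; rewrite !inE !negb_or => /and4P [bu bu' bp bq].
have pu : p != u by apply: contraTneq uT => <-; rewrite in_cutset !inE eqxx.
have qu : q != u by apply: contraTneq uT => <-; rewrite in_cutset !inE eqxx orbT.
have pu' : p != u' by apply: contraTneq u'T => <-; rewrite in_cutset !inE eqxx.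
have qu' : q != u' by apply: contraTneq u'T => <-; rewrite in_cutset !inE eqxx orbT.
have [||r [sr ur eS]] := @set_rest _ (cutset C D) [:: p; q; u; b].
- by rewrite /= !inE !negb_or npq pu qu !(eq_sym _ b) bp bq bu.
- by move=> w; rewrite 4!inE => /or4P [] /eqP ->.
have [||r' [sr' ur' eS']] := @set_rest _ (cutset C' D') [:: p; q; u'; b].
- by rewrite /= !inE !negb_or npq pu' qu' !(eq_sym _ b) bp bq bu'.
- by move=> w; rewrite 4!inE => /or4P [] /eqP ->.
rewrite (fivesep_card f) in sr; rewrite (fivesep_card f') in sr'.
case: r sr ur eS => [//|b' [|//]] _ ub' eS; case: r' sr' ur' eS' => [//|c' [|//]] _ uc' eS'.
have b'S : b' \in cutset C D by rewrite eS !inE eqxx !orbT.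
have c'S' : c' \in cutset C' D' by rewrite eS' !inE eqxx !orbT.
have inB w X Y x y : sep X Y -> w \in cutset X Y -> w \notin [:: p; q] -> w != x -> y \in X -> i \in X ->
    (forall w, w \in cutset [set p; q] B -> w \notin [:: x; y; i] -> w \in Y) -> w \in B.
  move=> s wS; rewrite !inE negb_or => /andP [wp wq] wx yX iX rest.
  rewrite -[w \in B]negbK; apply/negP => wB.
  have wT : w \in cutset [set p; q] B by rewrite in_cutset !inE negb_or wp wq.
  have : w \in Y; last by rewrite (cutsetNr wS).
  apply: rest => //; rewrite !inE !negb_or wx /=.
  by apply/andP; split; apply: contraTneq wS => ->; rewrite in_cutset ?yX ?iX.
move: (ub') (uc'); rewrite /= !inE !negb_or => /and5P [/and4P [_ _ _ pb'] /and3P [_ _ qb'] /andP [_ ub'1] bb' _].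
case/and5P=> [/and4P [_ _ _ pc'] /and3P [_ _ qc'] /andP [_ u'c'] bc' _].
have bB : b \in B.
  by apply: (inB _ _ _ u u' sCD bS) => //; rewrite ?inE ?negb_or ?bp ?bq.
have b'B : b' \in B.
  apply: (inB _ _ _ u u' sCD b'S) => //; rewrite ?inE ?negb_or 1?eq_sym ?pb' //.
  by rewrite eq_sym.
have c'B : c' \in B.
  apply: (inB _ _ _ u' u sCD' c'S') => //; rewrite ?inE ?negb_or 1?eq_sym ?pc' //.
  by rewrite eq_sym.
have b'c' : b' != c'.
  apply/eqP => e; pose X := [set u; u'; i].
  have [] := @small_closed G qG oG X [:: p; q; b; b'].
  - move=> v w; rewrite /X !inE -!orbA => /or3P [] /eqP ->.
    + by rewrite Nu eS' -e !inE; split_eqs w.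
    + by rewrite Nu' eS !inE; split_eqs w.
    + move=> iw; case: (boolP (w \in [:: u; u'; p; q])) => [|wl].
        by rewrite !inE; split_eqs w.
      have [] := Ni w iw wl; rewrite eS eS' -e !inE; move: wl; rewrite !inE.
      by split_eqs w.
  - have dis v : v \in C -> v \notin [:: p; q; b; b'].
      move=> vC; apply/negP; rewrite !inE => /or4P [] /eqP ev; move: vC;
        by rewrite ev (cutsetNl pS, cutsetNl qS, cutsetNl bS, cutsetNl b'S).
    move=> v vX; have {vX} : [|| v == u, v == u' | v == i] by move: vX; rewrite /X !inE -!orbA.
    case/or3P => /eqP ->; [|exact: dis|exact: dis].
    by rewrite !inE !negb_or ![u == _]eq_sym pu qu bu eq_sym ub'1.
  - case/and4P: (f) => _ _ _ D1; apply: leq_trans D1 _; apply: subset_leq_card.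
    apply/subsetP => v vD; rewrite /X !inE -orbA !negb_or.
    have nS x : x \in cutset C D -> v != x by move=> xS; apply: contraTneq vD => ->; rewrite (cutsetNr xS).
    have nC x : x \in C -> v != x by move=> xC; apply: contraTneq vD => ->; rewrite (sep_disj sCD xC).
    by rewrite (nS u) // (nC u') // (nC i) // (nS p) // (nS q) // (nS b) // (nS b').
  - by [].
  - by apply/set0Pn; exists u; rewrite /X !inE eqxx.
  move=> m [eX _ _]; have := set11 m.
  have : #|X| <= 1 by rewrite eX cards1.
  by move/card_le1_eqP => /(_ u u'); rewrite /X !inE !eqxx ?orbT => /(_ isT isT) euu; rewrite euu eqxx in uu'.
have b'S' : (b' \in cutset C' D') = false.
  have u'b' : b' != u' by apply: contraTneq b'S => ->; rewrite in_cutset u'C.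
  by rewrite eS' !inE !(eq_sym b') (negbTE pb') (negbTE qb') eq_sym (negbTE u'b') (negbTE bb') eq_sym (negbTE b'c').
have Ni' w : i -- w -> w \in [:: u; u'; p; q; b].
  move=> iw; case: (boolP (w \in [:: u; u'; p; q])) => [|wl]; first by rewrite !inE; split_eqs w.
  have [] := Ni w iw wl; case: (eqVneq w b') => [->|wb']; first by rewrite b'S'.
  by rewrite eS !inE (negbTE wb'); split_eqs w.
have [E [F [fE iE bE]]] := edge_cutset blockedG deg5 ib.
have edges : [/\ p -- u, u -- u', u' -- q & q -- p].
  split; [rewrite sedge_sym Nu pS' npq|rewrite Nu u'S' (eq_sym u' q) qu'|rewrite Nu' qS (eq_sym q p) npq|by rewrite sedge_sym];
    exact: orbT.
have two X Y : fivesep X Y -> i \in cutset X Y -> b \in cutset X Y -> #|X| = 2.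
  move=> fX iX bX; have sXY := fivesep_sep fX.
  have [e eX ie] := fivesep_nbr qG fX iX.
  have [g gY ig] : exists2 g, g \in Y & i -- g.
    by apply: (@fivesep_nbr _ qG Y X); rewrite 1?fivesepC // cutsetC.
  apply: (lonely_card qG oG blockedG (@iso i) fX iX eX ie) => v vX iv.
  have nb x : x \in X \/ x \in Y -> i -- x -> x \in [:: u; u'; p; q].
    move=> xXY /Ni'; rewrite !inE orbA orbA orbA => /orP [|/eqP xb]; first by rewrite -!orbA.
    by case: xXY; rewrite xb (cutsetNl bX, cutsetNr bX).
  have := nb e (or_introl eX) ie; have := nb v (or_introl vX) iv; have := nb g (or_intror gY) ig.
  have no x y : x \in X -> y \in Y -> x != y /\ x -- y = false.
    move=> xX yY; split; last exact: sep_noedge sXY xX yY.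
    by apply: contraTneq xX => ->; apply: contraL yY => yX; rewrite (sep_disj sXY yX).
  have [ge1 ge2] := no _ _ eX gY; have [gv1 gv2] := no _ _ vX gY.
  case: edges => e1 e2 e3 e4; clear -e1 e2 e3 e4 ge1 ge2 gv1 gv2.
  rewrite !inE => /or4P [] /eqP ?; subst g => /or4P [] /eqP ?; subst v => /or4P [] /eqP ?; subst e => //;
  by move: e1 e2 e3 e4 ge1 ge2 gv1 gv2;
    rewrite ?eqxx ?(sedge_sym u p) ?(sedge_sym u' u) ?(sedge_sym q u') ?(sedge_sym p q);
    do 4!case: (_ -- _).
have := card_fivesep fE; rewrite (two E F) // (two F E) 1?fivesepC // 1?cutsetC //.
rewrite (card_fivesep fAB) cards2 npq.
have : 2 < #|B|; last by clear; lia.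
by apply/card_gt2P; exists b, b', c'; split; split; rewrite // eq_sym.
Qed.

End PairMissSame.

Section PairMissDiff.
Variable G : sgraph.
Implicit Types (A B C D E F T X : {set G}) (u v w z p q t : G).
Hypothesis qG : quasi5 G.
Hypothesis oG : 4 < #|G|.
Hypothesis blockedG : forall x y : G, x -- y -> blocked x y.
Hypothesis deg5 : forall v : G, 4 < deg v.

Let iso z : isolated_four z. Proof. exact: isolated_deg5. Qed.

Lemma miss_diff p q B u u' C D C' D' i i' :
  pairsep p q B -> u \in cutset [set p; q] B -> u' \in cutset [set p; q] B ->
  q -- u = false -> p -- u' = false ->
  fivesep C D -> p \in cutset C D -> q \in cutset C D -> u \in cutset C D ->
  C = [set i; u'] -> i != u' -> i != u -> i \in cutset [set p; q] B ->
  (forall w, (u' -- w) = (w == i) || (w \in cutset C D) && (w != p)) ->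
  (forall w, w \in cutset [set p; q] B -> w \notin [:: u; u'; i] -> w \in D) ->
  fivesep C' D' -> p \in cutset C' D' -> q \in cutset C' D' -> u' \in cutset C' D' ->
  C' = [set i'; u] -> i' != u -> i' != u' -> i' \in cutset [set p; q] B ->
  (forall w, (u -- w) = (w == i') || (w \in cutset C' D') && (w != q)) ->
  (forall w, w \in cutset [set p; q] B -> w \notin [:: u'; u; i'] -> w \in D') ->
  i != i' -> False.
Proof.
move=> pP uT u'T qu pu' f pS qS uS eC iu' iu iT Nu' restD
  f' pS' qS' u'S' eC' i'u i'u' i'T Nu restD' ii'.
have /andP [npq fAB] := pP.
have Nq := miss_nbrs qG deg5 pP uT qu.
have Np w : (p -- w) = (w == q) || (w \in cutset [set p; q] B) && (w != u').
  rewrite setUC; apply: miss_nbrs => //; first by rewrite pairsepC.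
  by rewrite setUC.
have pu : p -- u.
  by have := pairsep_nbr qG pP uT; rewrite (sedge_sym u q) qu orbF sedge_sym.
have uu' : u != u' by apply: contraFneq pu' => <-.
have pq : p -- q by rewrite Np eqxx.
have sCD := fivesep_sep f; have sCD' := fivesep_sep f'.
have iC : i \in C by rewrite eC !inE eqxx.
have u'C : u' \in C by rewrite eC !inE eqxx orbT.
have i'C' : i' \in C' by rewrite eC' !inE eqxx.
have uC' : u \in C' by rewrite eC' !inE eqxx orbT.
have i'D : i' \in D by apply: restD; rewrite // !inE !negb_or i'u i'u' eq_sym.
have iD' : i \in D' by apply: restD'; rewrite // !inE !negb_or iu' iu.
have [||r [sr ur eT]] := @set_rest _ (cutset [set p; q] B) [:: u; u'; i; i'].
- by rewrite /= !inE !negb_or uu' !(eq_sym _ i) iu iu' ii' !(eq_sym _ i') i'u i'u'.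
- by move=> w; rewrite 4!inE => /or4P [] /eqP ->.
rewrite (fivesep_card fAB) in sr; case: r sr ur eT => [//|k [|//]] _ uk eT.
have kT : k \in cutset [set p; q] B by rewrite eT !inE eqxx !orbT.
case/and5P: uk; rewrite !inE !negb_or => /and4P [_ _ _ uk] /and3P [_ _ u'k] /andP [_ ik] i'k _.
have kD : k \in D by apply: restD; rewrite // !inE !negb_or !(eq_sym k) uk u'k ik.
have kD' : k \in D' by apply: restD'; rewrite // !inE !negb_or !(eq_sym k) uk u'k i'k.
have nuk : u -- k = false by rewrite (sep_noedge sCD' uC' kD').
have ni'k : i' -- k = false by rewrite (sep_noedge sCD' i'C' kD').
have npT w : w \in cutset [set p; q] B -> (w != p) && (w != q).
  by rewrite in_cutset !inE negb_or => /andP [].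
have [||r [sr ur eS]] := @set_rest _ (cutset C D) [:: p; q; u].
- rewrite /= !inE !negb_or npq !(eq_sym _ u).
  by have /andP [-> ->] := npT u uT.
- by move=> w; rewrite 3!inE => /or3P [] /eqP ->.
rewrite (fivesep_card f) in sr; case: r sr ur eS => [//|b [//|b' [|//]]] _ ub eS.
have bS : b \in cutset C D by rewrite eS !inE eqxx !orbT.
have b'S : b' \in cutset C D by rewrite eS !inE eqxx !orbT.
case/and5P: ub; rewrite !inE !negb_or => /and4P [_ _ pb pb'] /and3P [_ qb qb'] /andP [ub ub'] bb' _.
have nT w : w \in cutset C D -> w != u -> w \in cutset [set p; q] B -> False.
  move=> wS wu wT; have := restD w wT; rewrite !inE !negb_or wu !(eq_sym w).
  by rewrite (cutset_neql u'C wS) (cutset_neql iC wS) (cutsetNr wS) => /(_ isT).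
have bT : b \notin cutset [set p; q] B by apply/negP; apply: nT; rewrite // eq_sym.
have b'T : b' \notin cutset [set p; q] B by apply/negP; apply: nT; rewrite // eq_sym.
have neT x y : x \notin cutset [set p; q] B -> y \in cutset [set p; q] B -> x != y.
  by move=> xT; apply: contraTneq => <-.
have Ni w : (i -- w) = (w \in [:: u'; p; q; b; b']).
  apply: nbrs_list => [|{}w iw]; first exact: deg5.
  have := sep_nbr sCD iC iw; case: (boolP (w \in C)) => [|wC wD].
    rewrite eC !inE => /orP [/eqP wi|->] //.
    by move: iw; rewrite wi sedge_irr.
  have : w \in cutset C D by rewrite in_cutset wC.
  rewrite eS !inE; case: (eqVneq w u) => [wu|_]; last by split_eqs w.
  by move: iw; rewrite wu sedge_sym (sep_noedge sCD' uC' iD').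
have u'q : u' -- q by rewrite Nu' qS (eq_sym q p) npq orbT.
have u'b : u' -- b by rewrite Nu' bS (eq_sym b p) pb orbT.
have u'b' : u' -- b' by rewrite Nu' b'S (eq_sym b' p) pb' orbT.
have sw E F : fivesep E F -> i \in cutset E F -> b \in cutset E F ->
    [/\ fivesep F E, i \in cutset F E & b \in cutset F E].
  by move=> ? ? ?; rewrite fivesepC cutsetC.
have nbE E F : fivesep E F -> i \in cutset E F -> b \in cutset E F ->
    exists2 e, e \in E & e \in [:: u'; p; q; b'].
  move=> fE iE bE; have [e eE ie] := fivesep_nbr qG fE iE.
  exists e => //; move: ie; rewrite Ni !inE; case: (eqVneq e b) => [eb|_]; last by split_eqs e.
  by move: eE; rewrite eb (cutsetNl bE).
have lone E F x : fivesep E F -> i \in cutset E F -> b \in cutset E F -> x \in E ->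
    i -- x -> (forall y, y \in [:: u'; p; q; b'] -> y != x -> y \notin E) ->
    exists v, [/\ E = [set x; v], v != x, (i -- v) = false &
      forall w, (v -- w) = (w == x) || (w \in cutset E F) && (w != i)].
  move=> fE iE bE xE ix no.
  have lx v : v \in E -> i -- v -> v = x.
    move=> vE; rewrite Ni => vl; apply/eqP; apply/negP => /negP vx.
    suff /no/(_ vx) : v \in [:: u'; p; q; b'] by rewrite vE.
    move: vl; rewrite !inE; case: (eqVneq v b) => [vb|_]; last by split_eqs v.
    by move: vE; rewrite vb (cutsetNl bE).
  have c2 := lonely_card qG oG blockedG (@iso i) fE iE xE ix lx.
  have [v [e1 e2 e3 /(_ (deg5 v)) e4]] := lonely_mate fE iE xE ix lx c2.
  by exists v.
have alpha E F : fivesep E F -> i \in cutset E F -> b \in cutset E F ->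
    p \in E -> u' \notin E -> q \notin E -> b' \notin E -> False.
  move=> fE iE bE pE u'E qE b'E; have sE := fivesep_sep fE.
  have [|y|v [eE vp niv Nv]] := lone E F p fE iE bE pE.
  - by rewrite Ni !inE eqxx !orbT.
  - by rewrite !inE => /or4P [] /eqP -> //; rewrite eqxx.
  have vE : v \in E by rewrite eE !inE eqxx orbT.
  have inS w : p -- w -> w != p -> w != v -> w \in cutset E F.
    by move=> pw wp wv; rewrite in_cutset (sep_nbr sE pE pw) eE !inE negb_or wp wv.
  have vT : v \in cutset [set p; q] B.
    have := Nv p; rewrite eqxx sedge_sym Np /= => /orP [/eqP vq|/andP []//].
    by rewrite -vq vE in qE.
  have pT w : w \in cutset [set p; q] B -> w != u' -> w != v -> w \in cutset E F.
    by move=> wT wu' wv; apply: inS => //; [rewrite Np wT wu' orbT|case/andP: (npT w wT)].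
  move: (vT); rewrite eT !inE => /or4P [/eqP e|/eqP e|/eqP e|/orP [] /eqP e].
  - have kS : k \in cutset E F by apply: pT; rewrite // eq_sym ?e.
    by have := Nv k; rewrite e nuk kS (eq_sym k i) ik orbT.
  - by rewrite -e vE in u'E.
  - by move: vE; rewrite e (cutsetNl iE).
  - have kS : k \in cutset E F by apply: pT; rewrite // eq_sym ?e.
    by have := Nv k; rewrite e ni'k kS (eq_sym k i) ik orbT.
  - have uS' : u \in cutset E F by apply: pT; rewrite // e.
    by have := Nv u; rewrite e sedge_sym nuk uS' (eq_sym u i) iu orbT.
have beta E F : fivesep E F -> i \in cutset E F -> b \in cutset E F ->
    u' \in cutset E F -> b' \in F -> q \in E -> p \notin F -> False.
  move=> fE iE bE u'E b'F qE pF; have sE := fivesep_sep fE.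
  have [fF iF bF] := sw _ _ fE iE bE.
  have [|y|v [eF vb' niv Nv]] := lone F E b' fF iF bF b'F.
  - by rewrite Ni !inE eqxx !orbT.
  - rewrite !inE => /or4P [] /eqP ->; rewrite ?eqxx ?(cutsetNr u'E) // => _.
    by rewrite (sep_disj sE qE).
  have vF : v \in F by rewrite eF !inE eqxx orbT.
  have {Nv}Nv w : (v -- w) = (w == b') || (w \in cutset E F) && (w != i) by rewrite cutsetC Nv.
  have vu : v = u.
    have : u' -- v by rewrite sedge_sym Nv u'E (eq_sym u' i) iu' orbT.
    rewrite Nu' eS !inE => /orP [/eqP e|].
      by move: vF; rewrite e (cutsetNr iE).
    case/andP => /or3P [/eqP e|/eqP e|/or3P [/eqP //|/eqP e|/eqP e]] vp.
    - by rewrite e eqxx in vp.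
    - by move: vF; rewrite e (sep_disj sE qE).
    - by move: vF; rewrite e (cutsetNr bE).
    - by rewrite e eqxx in vb'.
  rewrite {}vu in eF vF Nv.
  case: (boolP (p \in E)) => pE; first exact: (sep_false sE pE vF pu).
  have [|y|v' [eE v'q niv' Nv']] := lone E F q fE iE bE qE.
  - by rewrite Ni !inE eqxx !orbT.
  - rewrite !inE => /or4P [] /eqP ->; rewrite ?eqxx ?(cutsetNl u'E) ?pE // => _.
    by apply/negP => b'E; move: b'F; rewrite (sep_disj sE b'E).
  have kE : k \in E.
    have qk : q -- k by rewrite Nq kT (eq_sym k u) uk orbT.
    apply: contraFT nuk => kE; rewrite Nv in_cutset kE (eq_sym k i) ik.
    by rewrite (sep_nbr sE qE qk) orbT.
  have v'k : v' = k.
    by move: kE; rewrite eE !inE => /orP [/eqP e|/eqP //]; have := npT k kT; rewrite e eqxx andbF.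
  have i'S' : i' \in cutset E F.
    by have := Nu i'; rewrite eqxx Nv eq_sym (negbTE (neT _ _ b'T i'T)) /= => /andP [].
  by have := Nv' i'; rewrite v'k sedge_sym ni'k i'S' (eq_sym i' i) ii' orbT.
have gamma E F : fivesep E F -> i \in cutset E F -> b \in cutset E F -> p \in E -> False.
  move=> fE iE bE pE; have sE := fivesep_sep fE; have pF := sep_disj sE pE.
  have [fF iF bF] := sw _ _ fE iE bE.
  have [e eF el] := nbE F E fF iF bF.
  have qF : q \notin F by apply: (sep_nbr sE pE pq).
  have {}el : (e == u') || (e == b').
    move: el; rewrite !inE; case: (eqVneq e p) => [ep|_]; first by rewrite -ep eF in pF.
    by case: (eqVneq e q) => [eq|_]; [rewrite -eq eF in qF|split_eqs e].
  have noE x y : x \in E -> y \in F -> x -- y = false by apply: sep_noedge.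
  case: (boolP (q \in E)) => qE.
    have u'F : u' \notin F by apply: (sep_nbr sE qE); rewrite sedge_sym.
    case/orP: el => /eqP ee; first by rewrite -ee eF in u'F.
    rewrite {}ee in eF; apply: (beta E F) => //; last by rewrite pF.
    rewrite in_cutset u'F andbT; apply/negP => u'E.
    by have := noE _ _ u'E eF; rewrite u'b'.
  apply: (alpha E F) => //.
    apply/negP => u'E; case/orP: el => /eqP ee; rewrite {}ee in eF.
      by rewrite (sep_disj sE u'E) in eF.
    by have := noE _ _ u'E eF; rewrite u'b'.
  apply/negP => b'E; case/orP: el => /eqP ee; rewrite {}ee in eF.
    by have := noE _ _ b'E eF; rewrite sedge_sym u'b'.
  by rewrite (sep_disj sE b'E) in eF.
have ib : i -- b by rewrite Ni !inE eqxx !orbT.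
have [E [F [fE iE bE]]] := edge_cutset blockedG deg5 ib.
have [fF iF bF] := sw _ _ fE iE bE.
have pE : p \notin E by apply/negP; apply: gamma fE iE bE.
have pF : p \notin F by apply/negP; apply: gamma fF iF bF.
have sE := fivesep_sep fE.
have mid X Y : fivesep X Y -> i \in cutset X Y -> b \in cutset X Y -> p \notin X -> p \notin Y ->
    q \in X -> b' \in Y -> False.
  move=> fX iX bX pX pY qX b'Y; apply: (beta X Y) => //.
  rewrite in_cutset (sep_nbr (fivesep_sep fX) qX) ?andbT; last by rewrite sedge_sym.
  apply/negP => u'X; by have := sep_noedge (fivesep_sep fX) u'X b'Y; rewrite u'b'.
have [e eE el] := nbE E F fE iE bE; have [g gF gl] := nbE F E fF iF bF.
have ne := sep_noedge sE eE gF; have nd := sep_neq sE eE gF.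
move: el gl; rewrite !inE => /or4P [] /eqP ee; subst e => /or4P [] /eqP eg; subst g;
  rewrite ?eqxx // in nd; rewrite ?eE ?gF // in pE pF *.
all: try by [rewrite u'q in ne|rewrite u'b' in ne|rewrite sedge_sym u'q in ne|rewrite sedge_sym u'b' in ne].
- exact: (mid E F).
- exact: (mid F E).
Qed.
End PairMissDiff.

Section FiveConnectedAbsurd.
Variable G : sgraph.
Implicit Types (A B C D E F T X Y : {set G}) (u v w x y z p q t : G).
Hypothesis qG : quasi5 G.
Hypothesis oG : 4 < #|G|.
Hypothesis blockedG : forall x y : G, x -- y -> blocked x y.
Hypothesis deg5 : forall v : G, 4 < deg v.

Let iso z : isolated_four z. Proof. exact: isolated_deg5. Qed.

Lemma pairsep_miss p q B u u' :
  pairsep p q B -> u \in cutset [set p; q] B -> u' \in cutset [set p; q] B ->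
  q -- u = false -> p -- u' = false -> False.
Proof.
move=> pP uT u'T qu pu'; have /andP [npq _] := pP.
have pu : p -- u.
  by have := pairsep_nbr qG pP uT; rewrite (sedge_sym u q) qu orbF sedge_sym.
have uu' : u != u' by apply: contraFneq pu' => <-.
have pq : p -- q.
  by rewrite sedge_sym (miss_nbrs qG deg5 pP uT qu) eqxx.
have [C [D [i [[f [pS qS] uS [eC iu'] [iT iu Nu' restD]]]]]] :=
  half_miss qG oG blockedG deg5 pP uT u'T qu pu'.
have [] := @half_miss G qG oG blockedG deg5 q p B u' u.
- by rewrite pairsepC.
- by rewrite setUC.
- by rewrite setUC.
- by [].
- by [].
move=> C' [D' [i' [[f' [qS' pS'] u'S' [eC' i'u] [i'T i'u' Nu restD']]]]].
rewrite setUC in i'T restD'.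
case: (eqVneq i i') => [ii'|ii'].
  by subst i'; apply: (miss_same qG oG blockedG deg5 pP uT u'T uu' pq f pS qS uS eC iu' iu iT
    Nu' restD f' pS' qS' u'S' eC' Nu restD').
by apply: (miss_diff qG oG blockedG deg5 pP uT u'T qu pu' f pS qS uS eC iu' iu iT
    Nu' restD f' pS' qS' u'S' eC' i'u i'u' i'T Nu restD').
Qed.

Lemma pairsep_both p q B C D :
  pairsep p q B -> (forall t, t \in cutset [set p; q] B -> p -- t) ->
  fivesep C D -> q \in cutset C D -> p \in cutset C D.
Proof.
move=> pP pT f qS.
have no E F : fivesep E F -> q \in cutset E F -> p \notin E.
  move=> fE qE; apply/negP => pE; have [v vF qv] : exists2 v, v \in F & q -- v.
    by apply: (@fivesep_nbr _ qG F E); rewrite 1?fivesepC // cutsetC.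
  have vp : v != p by rewrite eq_sym; apply: (sep_neq (fivesep_sep fE) pE vF).
  have : v \in cutset [set q; p] B by apply: pairsep_nbr_in; rewrite // pairsepC.
  by rewrite setUC => /pT; rewrite (sep_noedge (fivesep_sep fE) pE vF).
by rewrite in_cutset (no C D) // (no D C) // 1?fivesepC 1?cutsetC.
Qed.

Lemma pairsep_complete p q B :
  pairsep p q B -> forall u, u \in cutset [set p; q] B -> q -- u.
Proof.
move=> pP u uT; case qu: (q -- u) => //; exfalso.
have pT t : t \in cutset [set p; q] B -> p -- t.
  by move=> tT; case pt: (p -- t) => //; case: (pairsep_miss pP uT tT qu pt).
have claim t : t \in cutset [set p; q] B -> t != u -> (u -- t) /\
    exists s, [/\ s \in cutset [set p; q] B, s != u & u -- s = false].
  move=> tT tu; have qt : q -- t by rewrite (miss_nbrs qG deg5 pP uT qu) tT tu orbT.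
  have [C0 [D0 [f0 qS0 tS0]]] := edge_cutset blockedG deg5 qt.
  have pS0 := pairsep_both pP pT f0 qS0.
  have [_ _ TCD] := pairsep_cut qG oG deg5 pP f0 pS0 qS0 tT tS0.
  have ut : u != t by rewrite eq_sym.
  have [C [D [f eS uC]]] := fivesep_orient f0 (TCD u uT ut).
  rewrite -eS in pS0 qS0 tS0.
  have [TC TD _] := pairsep_cut qG oG deg5 pP f pS0 qS0 tT tS0.
  have [|||i [eC iu iT Nu]] := pairsep_lone_side qG oG blockedG deg5 (p:=q) (q:=p) (B:=B) _ f qS0 pS0 _ _ uC qu.
  - by rewrite pairsepC.
  - by rewrite setUC.
  - by rewrite setUC.
  split; first by rewrite Nu tS0 (_ : t != q) ?orbT //; move: tT; rewrite in_cutset !inE negb_or => /andP [/andP []].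
  have /card_gt0P [s] : 0 < #|cutset [set p; q] B :&: D| by rewrite TD.
  rewrite inE => /andP [sT sD]; exists s; split=> //.
    by rewrite eq_sym (sep_neq (fivesep_sep f) uC sD).
  exact: (sep_noedge (fivesep_sep f) uC sD).
have /andP [_ fAB] := pP.
have /card_gt1P [t1 [t2 [t1T t2T t12]]] : 1 < #|cutset [set p; q] B| by rewrite (fivesep_card fAB).
have [t tT tu] : exists2 t, t \in cutset [set p; q] B & t != u.
  by case: (eqVneq t1 u) => [e|?]; [exists t2; rewrite // -e eq_sym | exists t1].
have [_ [s [sT su us]]] := claim t tT tu.
by have [] := claim s sT su; rewrite us.
Qed.

Lemma pairsep_good_cut p q B t :
  pairsep p q B -> t \in cutset [set p; q] B ->
  exists C D, [/\ fivesep C D, p \in cutset C D, q \in cutset C D & t \in cutset C D].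
Proof.
move=> pP tT; have pP' : pairsep q p B by rewrite pairsepC.
have [C [D [f qS tS]]] := edge_cutset blockedG deg5 (pairsep_complete pP tT).
exists C, D; split=> //; apply: (pairsep_both pP _ f qS) => s sT.
by apply: (pairsep_complete pP'); rewrite setUC.
Qed.

Lemma pairsep_matching p q B w w1 w2 :
  pairsep p q B -> w \in cutset [set p; q] B -> w1 \in cutset [set p; q] B ->
  w2 \in cutset [set p; q] B -> w1 != w2 -> w -- w1 -> w -- w2 -> False.
Proof.
move=> pP wT w1T w2T w12 ww1 ww2; have /andP [_ fAB] := pP.
have ne x : w -- x -> w != x by apply: contraTneq => ->; rewrite sedge_irr.
have [||r [sr ur eT]] := @set_rest _ (cutset [set p; q] B) [:: w; w1; w2].
- by rewrite /= !inE negb_or w12 (ne w1) ?(ne w2).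
- by move=> x; rewrite 3!inE => /or3P [] /eqP ->.
rewrite (fivesep_card fAB) in sr; case: r sr ur eT => [//|t r] _ ur eT.
have tT : t \in cutset [set p; q] B by rewrite eT !inE eqxx !orbT.
have [C0 [D0 [f0 pS qS tS]]] := pairsep_good_cut pP tT.
have [_ _ TCD] := pairsep_cut qG oG deg5 pP f0 pS qS tT tS.
move: ur; rewrite /= !inE !negb_or => /and4P [/and4P [_ _ wt _] /and3P [_ w1t _] /andP [w2t _] _].
have [C [D [f eS wC]]] := fivesep_orient f0 (TCD w wT wt).
rewrite -eS in pS qS tS; have [TC _ {}TCD] := pairsep_cut qG oG deg5 pP f pS qS tT tS.
have inC x : x \in cutset [set p; q] B -> x != t -> w -- x -> x \in C.
  move=> xT xt wx; case/orP: (TCD x xT xt) => // xD.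
  by rewrite (sep_noedge (fivesep_sep f) wC xD) in wx.
have : 2 < #|cutset [set p; q] B :&: C|; last by rewrite TC.
apply/card_gt2P; exists w, w1, w2; split; split; rewrite ?in_setI ?wT ?w1T ?w2T ?wC ?inC //.
  exact: ne.
by rewrite eq_sym ne.
Qed.

Lemma trimmed_cutset X Y p q :
  sep X Y -> X != set0 -> Y != set0 -> p != q -> p \in cutset X Y -> q \in cutset X Y ->
  (forall v, v \in X -> (p -- v = false) /\ (q -- v = false)) -> 6 < #|cutset X Y|.
Proof.
move=> sXY X0 Y0 pq pS qS no.
have sXY' : sep X (p |: (q |: Y)).
  apply: sep_intro => [v vX|u v uX]; rewrite !in_setU1 => /or3P [/eqP e|/eqP e|vY].
  - by move: pS; rewrite in_cutset -e vX.
  - by move: qS; rewrite in_cutset -e vX.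
  - by rewrite (sep_disj sXY vX) in vY.
  - by rewrite e sedge_sym (no u uX).1.
  - by rewrite e sedge_sym (no u uX).2.
  - by rewrite (sep_noedge sXY uX vY).
have := cutset_ge5 qG oG deg5 sXY' X0.
have -> : cutset X (p |: (q |: Y)) = cutset X Y :\ p :\ q.
  apply/setP => v; rewrite !inE !negb_or; case: (v == p); case: (v == q) => //=; by rewrite ?andbF.
rewrite -card_gt0 cardsU1 => H.
have {H} : 4 < #|cutset X Y :\ p :\ q|.
  apply: H; rewrite cardsU1; move: Y0; rewrite -card_gt0; case: (p \notin _) => //=.
  by case: (q \notin _); clear; lia.
have qS' : q \in cutset X Y :\ p by rewrite in_setD1 qS eq_sym pq.
rewrite (cardsD1 p (cutset X Y)) pS (cardsD1 q (cutset X Y :\ p)) qS'.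
by clear; lia.
Qed.

Lemma five_connected_absurd : False.
Proof.
have [p [q [B [pq fAB]]]] := edgesep_pair qG oG blockedG deg5.
case/andP => _ /exists_inP [x xT /exists_inP [y yT xy]].
have pP : pairsep p q B by rewrite /pairsep pq.
have pP' : pairsep q p B by rewrite pairsepC.
have qT := pairsep_complete pP.
have pT t : t \in cutset [set p; q] B -> p -- t.
  by move=> tT; apply: (pairsep_complete pP'); rewrite setUC.
have nxy : x != y by apply: contraTneq xy => ->; rewrite sedge_irr.
have [||r [sr ur eT]] := @set_rest _ (cutset [set p; q] B) [:: x; y].
- by rewrite /= inE nxy.
- by move=> z; rewrite 2!inE => /orP [] /eqP ->.
rewrite (fivesep_card fAB) in sr; case: r sr ur eT => [//|t [//|t' [//|i [|//]]]] _.
rewrite /= !inE !negb_or => /and5P [/and4P [_ xt xt' xi] /and3P [yt yt' yi] /andP [tt' ti] t'i _] eT.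
have tT : t \in cutset [set p; q] B by rewrite eT !inE eqxx !orbT.
have t'T : t' \in cutset [set p; q] B by rewrite eT !inE eqxx !orbT.
have iT : i \in cutset [set p; q] B by rewrite eT !inE eqxx !orbT.
have cut s s' : s \in cutset [set p; q] B -> s' \in cutset [set p; q] B -> s != s' ->
    x != s -> y != s -> x != s' -> y != s' -> s != i ->
    exists C D, [/\ fivesep C D, p \in cutset C D, q \in cutset C D & s \in cutset C D] /\
      [/\ x \in D, y \in D, s' \in C & i \in C].
  rewrite (eq_sym s s') (eq_sym s i) => sT s'T s's xs ys xs' ys' is1.
  have [C0 [D0 [f0 pS qS sS]]] := pairsep_good_cut pP sT.
  have [_ _ TCD] := pairsep_cut qG oG deg5 pP f0 pS qS sT sS.
  have [D [C [f eS xD]]] := fivesep_orient f0 (TCD x xT xs).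
  rewrite -eS in pS qS sS; have [TD _ {}TCD] := pairsep_cut qG oG deg5 pP f pS qS sT sS.
  have yD : y \in D.
    by case/orP: (TCD y yT ys) => // yC; rewrite (sep_noedge (fivesep_sep f) xD yC) in xy.
  have inC v : v \in cutset [set p; q] B -> v != s -> x != v -> y != v -> v \in C.
    move=> vT vs xv yv; case/orP: (TCD v vT vs) => // vD.
    have : 2 < #|cutset [set p; q] B :&: D|; last by rewrite TD.
    by apply/card_gt2P; exists x, y, v; rewrite !(in_setI, xT, yT, vT, xD, yD, vD) nxy yv eq_sym xv.
  exists C, D; rewrite fivesepC cutsetC; split; split=> //; apply: inC => //.
have [C [D [[f pS qS tS] [xD yD t'C iC]]]] := cut t t' tT t'T tt' xt yt xt' yt' ti.
have t't : t' != t by rewrite eq_sym.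
have [C' [D' [[f' pS' qS' t'S'] [xD' yD' tC' iC']]]] := cut t' t t'T tT t't xt' yt' xt yt t'i.
have sCD := fivesep_sep f; have sCD' := fivesep_sep f'.
have [sDC sDC'] : sep D C /\ sep D' C' by rewrite sepC sCD sepC sCD'.
have nonbr X : (forall v, v \in X -> v \notin cutset [set p; q] B) -> p \notin X -> q \notin X ->
    forall v, v \in X -> (p -- v = false) /\ (q -- v = false).
  move=> XT pX qX v vX; split; apply: contraNF (XT v vX) => e.
    by apply: (pairsep_nbr_in pP e); apply: contraNneq qX => <-.
  rewrite setUC; apply: (pairsep_nbr_in pP' e); by apply: contraNneq pX => <-.
have big X Y E F : sep X Y -> sep E F -> p \in cutset X Y -> q \in cutset X Y ->
    p \in cutset E F -> q \in cutset E F -> (forall v, v \in X -> v \in E -> v \in cutset [set p; q] B -> False) ->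
    Y != set0 -> X :&: E != set0 -> 6 < #|cutset (X :&: E) (Y :|: F)|.
  move=> s1 s2 p1 q1 p2 q2 noT Y0 XE0; apply: (trimmed_cutset (p:=p) (q:=q)) => //.
  - exact: sep_corner.
  - by case/set0Pn: Y0 => v vY; apply/set0Pn; exists v; rewrite inE vY.
  - by rewrite in_cutset !inE (cutsetNl p1) (cutsetNr p1) (cutsetNr p2).
  - by rewrite in_cutset !inE (cutsetNl q1) (cutsetNr q1) (cutsetNr q2).
  - apply: nonbr; rewrite ?in_setI ?(cutsetNl p1) ?(cutsetNl q1) // => v.
    by rewrite in_setI => /andP [vX vE]; apply/negP; apply: noT.
have D0 : D != set0 by apply/set0Pn; exists x.
have C0 : C != set0 by apply/set0Pn; exists i.
have noCD v : v \in C -> v \in D' -> v \in cutset [set p; q] B -> False.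
  move=> vC vD'; rewrite eT !inE => /or4P [/eqP e|/eqP e|/eqP e|/orP [] /eqP e].
  - by move: vC; rewrite e (sep_disj sDC xD).
  - by move: vC; rewrite e (sep_disj sDC yD).
  - by move: vC; rewrite e (cutsetNl tS).
  - by move: vD'; rewrite e (cutsetNr t'S').
  - by move: vD'; rewrite e (sep_disj sCD' iC').
have noDC v : v \in D -> v \in C' -> v \in cutset [set p; q] B -> False.
  move=> vD vC'; rewrite eT !inE => /or4P [/eqP e|/eqP e|/eqP e|/orP [] /eqP e].
  - by move: vC'; rewrite e (sep_disj sDC' xD').
  - by move: vC'; rewrite e (sep_disj sDC' yD').
  - by move: vD; rewrite e (cutsetNr tS).
  - by move: vC'; rewrite e (cutsetNl t'S').
  - by move: vD; rewrite e (sep_disj sCD iC).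
have hCD : C :&: D' != set0 -> 6 < #|cutset (C :&: D') (D :|: C')|.
  by apply: big; rewrite // cutsetC.
have hDC : D :&: C' != set0 -> 6 < #|cutset (D :&: C') (C :|: D')|.
  by apply: big; rewrite // 1?cutsetC // cutsetC.
have sCC := sep_corner sCD sCD'; have sDD := sep_corner sDC sDC'.
have iCC : i \in C :&: C' by rewrite inE iC.
have hCC : 4 < #|cutset (C :&: C') (D :|: D')|.
  apply: cutset_ge5 => //; first by apply/set0Pn; exists i.
  by apply/set0Pn; exists x; rewrite inE xD.
have hDD : 4 < #|cutset (D :&: D') (C :|: C')|.
  apply: cutset_ge5 => //; first by apply/set0Pn; exists x; rewrite inE xD.
  by apply/set0Pn; exists i; rewrite inE iC.
have hCC1 : 1 < #|C :&: C'| -> 5 < #|cutset (C :&: C') (D :|: D')|.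
  rewrite (cardsD1 i) iCC add1n ltnS card_gt0 => X0.
  have sX : sep ((C :&: C') :\ i) (D :|: D').
    apply: sep_intro => [v|u v]; rewrite in_setD1 => /andP [_ vX]; first by rewrite (sep_disj sCC vX).
    by move=> vD; rewrite (sep_noedge sCC vX vD).
  have : 6 < #|cutset ((C :&: C') :\ i) (D :|: D')|.
    apply: (trimmed_cutset (p:=p) (q:=q)) => //.
    - by apply/set0Pn; exists x; rewrite inE xD.
    - by rewrite in_cutset !inE (cutsetNl pS) (cutsetNr pS) (cutsetNr pS') andbF.
    - by rewrite in_cutset !inE (cutsetNl qS) (cutsetNr qS) (cutsetNr qS') andbF.
    - apply: nonbr; rewrite ?in_setD1 ?in_setI ?(cutsetNl pS) ?(cutsetNl qS) ?andbF // => v.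
      rewrite in_setD1 in_setI => /and3P [vi vC vC']; rewrite eT !inE !negb_or vi andbT.
      rewrite !(eq_sym v) (sep_neq sDC xD vC) (sep_neq sDC yD vC).
      by rewrite eq_sym (cutset_neql vC tS) eq_sym (cutset_neql vC' t'S').
  have -> : cutset ((C :&: C') :\ i) (D :|: D') = i |: cutset (C :&: C') (D :|: D').
    apply/setP => v; rewrite in_setU1 !in_cutset in_setD1.
    case: (eqVneq v i) => [->|//] /=; rewrite inE.
    by rewrite (sep_disj sCD iC) (sep_disj sCD' iC').
  by rewrite cardsU1; case: (i \notin _); clear; lia.
have [eCC eCD eDC eDD] := card_corners sCD sCD'.
have [[eC eD eS] [eC' eD' eS']] := card_cells sCD sCD'.
have cS := fivesep_card f; have cS' := fivesep_card f'.
have SS2 : 1 < #|cutset C D :&: cutset C' D'|.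
  by apply/card_gt1P; exists p, q; rewrite !in_setI pS pS' qS qS'.
have tSC : 0 < #|cutset C D :&: C'| by apply/card_gt0P; exists t; rewrite inE tS.
have t'CS : 0 < #|C :&: cutset C' D'| by apply/card_gt0P; exists t'; rewrite inE t'C.
have DD2 : 1 < #|D :&: D'| by apply/card_gt1P; exists x, y; rewrite !in_setI xD xD' yD yD'.
have CC1 : 0 < #|C :&: C'| by apply/card_gt0P; exists i.
rewrite -!card_gt0 in hCD hDC.
have : #|C| = 2 \/ #|C'| = 2.
  clear -hCD hDC hCC hDD hCC1 eCC eCD eDC eDD eC eD eS eC' eD' eS' cS cS' SS2 tSC t'CS DD2 CC1.
  by lia.
have final E F s s' : fivesep E F -> p \in cutset E F -> q \in cutset E F -> s \in cutset E F ->
    s \in cutset [set p; q] B -> s' \in E -> i \in E -> s' != i -> #|E| = 2 -> False.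
  move=> fE pE qE sE sT s'E iE s'i E2.
  have eE : E = [set s'; i].
    apply/esym/eqP; rewrite eqEcard cards2 s'i E2 andbT; apply/subsetP => v.
    by rewrite in_set2 => /orP [] /eqP ->.
  have P2 : pairsep s' i F by rewrite /pairsep s'i -eE.
  rewrite eE in pE qE sE.
  by apply: (pairsep_matching P2 sE pE qE pq); rewrite sedge_sym ?pT ?qT.
by case; [apply: (final C D t t') | apply: (final C' D' t' t)].
Qed.

End FiveConnectedAbsurd.

(** * Vertices of degree four *)

Section DegreeFour.
Variable G : sgraph.
Implicit Types (A B C D E F T X Y : {set G}) (u v w z a x : G).
Hypothesis qG : quasi5 G.
Hypothesis oG : 4 < #|G|.
Hypothesis blockedG : forall x y : G, x -- y -> blocked x y.
Hypothesis iso4 : forall z : G, deg z = 4 -> isolated_four z.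

Lemma near_adj z v : deg z = 4 -> z -- v -> 4 < deg v.
Proof.
move=> dz zv; apply: (iso4 dz); last by rewrite zv.
by apply: contraTneq zv => ->; rewrite sedge_irr.
Qed.

Lemma near_dist2 z w v : deg z = 4 -> z -- w -> w -- v -> v != z -> 4 < deg v.
Proof.
move=> dz zw wv vz; apply: (iso4 dz vz); apply/orP; right.
by apply/existsP; exists w; rewrite zw.
Qed.

Lemma cutset_near z u v :
  deg z = 4 -> z -- u -> u -- v -> z -- v = false ->
  exists C D, [/\ fivesep C D, u \in cutset C D & v \in cutset C D].
Proof.
move=> dz zu uv zv; case/orP: (blockedG uv) => [/existsP [w /and3P [wu wv /eqP dw]]|].
  have wz : w != z by apply: contraTneq wv => ->; rewrite zv.
  by have := near_dist2 dz zu (etrans (sedge_sym u w) wu) wz; rewrite dw.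
by case/existsP => C /existsP [D /and3P [fCD uS vS]]; exists C, D.
Qed.

Lemma lone_side z y C D :
  deg z = 4 -> z -- y -> fivesep C D -> z \in cutset C D -> y \in cutset C D ->
  exists A B a, [/\ fivesep A B, cutset A B = cutset C D &
    A = C /\ B = D \/ A = D /\ B = C] /\
    [/\ a \in A, z -- a & forall v, v \in A -> z -- v -> v = a].
Proof.
move=> dz zy f zS yS; have := card_split (nbrs z) (fivesep_sep f).
rewrite -[#|nbrs z|]/(deg z) dz.
have [c cC zc] := fivesep_nbr qG f zS.
have [d dD zd] : exists2 d, d \in D & z -- d.
  by apply: (@fivesep_nbr _ qG D C); rewrite 1?fivesepC // cutsetC.
have C0 : 0 < #|nbrs z :&: C| by apply/card_gt0P; exists c; rewrite in_setI inE zc.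
have D0 : 0 < #|nbrs z :&: D| by apply/card_gt0P; exists d; rewrite in_setI inE zd.
have S0 : 0 < #|nbrs z :&: cutset C D|.
  by apply/card_gt0P; exists y; rewrite in_setI inE zy.
have lone X u : u \in X -> z -- u -> #|nbrs z :&: X| <= 1 -> forall v, v \in X -> z -- v -> v = u.
  move=> uX zu /card_le1_eqP le1 v vX zv.
  by apply: le1; rewrite in_setI inE ?zu ?zv.
case: (leqP #|nbrs z :&: C| 1) => [C1 _|C1].
  by exists C, D, c; split; split=> //; [left | apply: lone].
case: (leqP #|nbrs z :&: D| 1) => [D1 _|D1]; last by move: C1 D1 S0; clear; lia.
by exists D, C, d; rewrite fivesepC cutsetC; split; split=> //; [right | apply: lone].
Qed.

Lemma lone_mate z y A B a :
  deg z = 4 -> z -- y -> fivesep A B -> z \in cutset A B -> y \in cutset A B ->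
  a \in A -> z -- a -> (forall v, v \in A -> z -- v -> v = a) ->
  exists a', [/\ A = [set a; a'], a' != a, z -- a' = false, 4 < deg a' &
    forall w, (a' -- w) = (w == a) || (w \in cutset A B) && (w != z)].
Proof.
move=> dz zy f zT yT aA za lone.
have c2 := lonely_card qG oG blockedG (iso4 dz) f zT aA za lone.
have [a' [eA a'a za' N]] := lonely_mate f zT aA za lone c2.
exists a'; suff d5 : 4 < deg a' by split=> //; apply: N.
have a'A : a' \in A by rewrite eA !inE eqxx orbT.
have a'z : a' != z by apply: cutset_neql a'A zT.
rewrite ltnNge; apply/negP => d4.
have a'_a : a' -- a = false.
  apply/negP => e; have := near_dist2 dz za (etrans (sedge_sym a a') e) a'z.
  by rewrite ltnNge d4.
have sub : nbrs a' \subset cutset A B :\ z.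
  apply/subsetP => w; rewrite inE => a'w; rewrite in_setD1 in_cutset.
  rewrite (sep_nbr (fivesep_sep f) a'A a'w) andbT; apply/andP; split.
    by apply: contraFneq za' => <-; rewrite sedge_sym.
  rewrite eA !inE negb_or; apply/andP; split; apply: contraTneq a'w => ->; first by rewrite a'_a.
  by rewrite sedge_irr.
have e : nbrs a' = cutset A B :\ z.
  apply/eqP; rewrite eqEcard sub /=; apply: leq_trans (deg_ge4 qG oG a').
  by have := cardsD1 z (cutset A B); rewrite zT (fivesep_card f); clear; lia.
have a'y : a' -- y.
  have : y \in nbrs a'; last by rewrite inE.
  by rewrite e in_setD1 yT andbT; apply: contraTneq zy => ->; rewrite sedge_irr.
by have := near_dist2 dz zy (etrans (sedge_sym y a') a'y) a'z; rewrite ltnNge d4.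
Qed.

(* [{a, a'}] and [{x, x'}] are sides of two nontrivial 5-cuts through [z], and [a], [x] are the
   only neighbours of [z] on them; [B] and [Y] are the opposite sides. *)
Record hub z a a' x x' B Y c d b b' : Prop := Hub {
  hub_sepA : fivesep [set a; a'] B;
  hub_sepX : fivesep [set x; x'] Y;
  hub_T : cutset [set a; a'] B =i [:: z; x; x'; c; d];
  hub_S : cutset [set x; x'] Y =i [:: z; a; a'; b; b'];
  hub_za : z -- a;
  hub_zx : z -- x;
  hub_za' : z -- a' = false;
  hub_zx' : z -- x' = false;
  hub_a' : forall w, (a' -- w) = (w \in [:: a; x; x'; c; d]);
  hub_x' : forall w, (x' -- w) = (w \in [:: x; a; a'; b; b']);
  hub_uniq : uniq [:: z; a; a'; x; x'; c; d; b; b']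
}.

Lemma hub_exists z : deg z = 4 -> exists a a' x x' B Y c d b b', hub z a a' x x' B Y c d b b'.
Proof.
move=> dz; have /card_gt0P [y] : 0 < #|nbrs z| by rewrite -[#|_|]/(deg z) dz.
rewrite inE => zy.
have [C0 [D0 [f0 zS0 yS0]]] := cutset_at_edge blockedG (iso4 dz) zy.
have [A [B [a [[fAB eT _] [aA za loneA]]]]] := lone_side dz zy f0 zS0 yS0.
rewrite -eT in zS0 yS0.
have [a' [eA a'a za' _ Na']] := lone_mate dz zy fAB zS0 yS0 aA za loneA.
have [C [D [fCD zS aS]]] := cutset_at_edge blockedG (iso4 dz) za.
have [cA AS TS TC TD] := lonely_cells qG oG (iso4 dz) fAB fCD zS0 zS aA aS za loneA.
have [X [Y [x [[fXY eS XY] [xX zx loneX]]]]] := lone_side dz za fCD zS aS.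
have TX : #|cutset A B :&: X| = 2 by case: XY => -[-> _].
rewrite -eS in zS aS TS AS.
have [x' [eX x'x zx' _ Nx']] := lone_mate dz za fXY zS aS xX zx loneX.
have XT : X \subset cutset A B.
  apply/setIidPr/eqP; rewrite eqEcard subsetIr TX eX cards2; by case: (_ != _).
have x'X : x' \in X by rewrite eX !inE eqxx orbT.
have a'A : a' \in A by rewrite eA !inE eqxx orbT.
have [xT x'T] : x \in cutset A B /\ x' \in cutset A B by split; apply: (subsetP XT).
have a'S : a' \in cutset X Y by apply: (subsetP AS).
have [||r [sr ur e5]] := @set_rest _ (cutset A B) [:: z; x; x'].
- rewrite /= !inE negb_or (eq_sym x) x'x !andbT !(eq_sym z).
  by rewrite !(cutset_neql (A:=X) (B:=Y)).
- by move=> w; rewrite 3!inE => /or3P [] /eqP ->.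
rewrite (fivesep_card fAB) in sr; case: r sr ur e5 => [//|c [//|d [|//]]] _ uT e5.
have [||r [sr ur e5']] := @set_rest _ (cutset X Y) [:: z; a; a'].
- rewrite /= !inE negb_or (eq_sym a) a'a !andbT !(eq_sym z).
  by rewrite !(cutset_neql (A:=A) (B:=B)).
- by move=> w; rewrite 3!inE => /or3P [] /eqP ->.
rewrite (fivesep_card fXY) in sr; case: r sr ur e5' => [//|b [//|b' [|//]]] _ uS e5'.
exists a, a', x, x', B, Y, c, d, b, b'; rewrite eA in fAB e5 aA a'A; rewrite eX in fXY e5' xX x'X.
have TS0 w : w \in cutset A B -> w \in cutset X Y -> w = z.
  by move=> wT wS; move/setP/(_ w): TS; rewrite in_setI in_set1 wT wS => /esym/eqP.
have disj : ~~ has (mem [:: z; x; x'; c; d]) [:: a; a'; b; b'].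
  apply/hasPn => w wl; apply/negP => /= wl'.
  have wS : w \in cutset X Y by rewrite eX e5' inE wl orbT.
  have wT : w \in cutset A B by rewrite eA e5.
  by move: uS wl; rewrite (TS0 w wT wS) => /= /andP [/negbTE ->].
split=> //.
- move=> w; rewrite Na' eA e5; case: (eqVneq w z) => [->|wz]; last first.
    by rewrite andbT !inE (negbTE wz).
  by move: disj; rewrite andbF orbF !inE /= => _; apply/esym; move: uT; rewrite /= !inE => /andP [/negbTE ->]; rewrite orbF.
- move=> w; rewrite Nx' eX e5'; case: (eqVneq w z) => [->|wz]; last first.
    by rewrite andbT !inE (negbTE wz).
  by rewrite andbF orbF !inE; move: uS; rewrite /= !inE => /andP [/negbTE ->]; rewrite orbF.
have pe : perm_eq [:: z; a; a'; x; x'; c; d; b; b'] ([:: z; x; x'; c; d] ++ [:: a; a'; b; b']).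
  by apply/permP => P /=; clear; lia.
rewrite (perm_uniq pe) cat_uniq uT disj; by move: uS => /= /andP [].
Qed.

Lemma hub_sym z a a' x x' B Y c d b b' :
  hub z a a' x x' B Y c d b b' -> hub z x x' a a' Y B b b' c d.
Proof.
case=> *; split=> //.
have pe : perm_eq [:: z; x; x'; a; a'; b; b'; c; d] [:: z; a; a'; x; x'; c; d; b; b'].
  by apply/permP => P /=; clear; lia.
by rewrite (perm_uniq pe).
Qed.

Lemma hub_swap z a a' x x' B Y c d b b' :
  hub z a a' x x' B Y c d b b' -> hub z a a' x x' B Y d c b b'.
Proof.
case=> sA sX eT eS za zx za' zx' Na' Nx' u; split=> //.
- by move=> w; rewrite eT !inE; split_eqs w.
- by move=> w; rewrite Na' !inE; split_eqs w.
have pe : perm_eq [:: z; a; a'; x; x'; d; c; b; b'] [:: z; a; a'; x; x'; c; d; b; b'].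
  by apply/permP => P /=; clear; lia.
by rewrite (perm_uniq pe).
Qed.

End DegreeFour.

Section Hub.
Variable G : sgraph.
Implicit Types (A B C D E F T X Y : {set G}) (u v w z a x : G).
Hypothesis qG : quasi5 G.
Hypothesis oG : 4 < #|G|.
Hypothesis blockedG : forall x y : G, x -- y -> blocked x y.
Hypothesis iso4 : forall z : G, deg z = 4 -> isolated_four z.

Section Structure.
Variables (z a a' x x' : G) (B Y : {set G}) (c d b b' : G).
Hypothesis dz : deg z = 4.
Hypothesis H : hub z a a' x x' B Y c d b b'.

Lemma hub_nbr_a w : a -- w -> w \in [:: a'; z; x; x'; c; d].
Proof.
move=> aw; have f := hub_sepA H; have aA : a \in [set a; a'] by rewrite !inE eqxx.
have wB := sep_nbr (fivesep_sep f) aA aw.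
case: (boolP (w \in [set a; a'])) => wA.
  move: wA aw; rewrite !inE => /orP [] /eqP ->; rewrite ?eqxx //.
  by rewrite sedge_irr.
have : w \in cutset [set a; a'] B by rewrite in_cutset wA.
by rewrite (hub_T H) => wl; rewrite in_cons wl orbT.
Qed.

Lemma hub_in_B : (b \in B) && (b' \in B).
Proof.
hub_neqs H.
by apply/andP; split; apply: (@in_rest _ [set a; a']);
  rewrite ?(hub_T H) !inE !negb_or; rewrite_neqs.
Qed.

End Structure.

Lemma hub_cut z a a' x x' B Y c d b b' :
  deg z = 4 -> hub z a a' x x' B Y c d b b' ->
  exists E F, [/\ fivesep E F, a \in cutset E F, x' \in cutset E F & z \in E].
Proof.
move=> dz H; hub_neqs H; have za := hub_za H; have fAB := hub_sepA H.
have ax' : a -- x' by rewrite sedge_sym (hub_x' H) !inE eqxx !orbT.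
have [E0 [F0 [f0 aS0 x'S0]]] := cutset_near blockedG iso4 dz za ax' (hub_zx' H).
have aA : a \in [set a; a'] by rewrite !inE eqxx.
have zT : z \in cutset [set a; a'] B by rewrite (hub_T H) !inE eqxx.
have loneA v : v \in [set a; a'] -> z -- v -> v = a.
  by rewrite in_set2 => /orP [] /eqP -> //; rewrite (hub_za' H).
have zS0 : z \notin cutset E0 F0.
  apply/negP => zS; have [_ _ e _ _] := lonely_cells qG oG (iso4 dz) fAB f0 zT zS aA aS0 za loneA.
  have : x' \in cutset [set a; a'] B :&: cutset E0 F0.
    by rewrite in_setI x'S0 (hub_T H) !inE eqxx !orbT.
  by rewrite e inE; rewrite_neqs.
have zEF : (z \in E0) || (z \in F0) by rewrite -[_ || _]negbK negb_or -in_cutset.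
have [E [F [f eEF zE]]] := fivesep_orient f0 zEF.
by exists E, F; rewrite eEF.
Qed.

Section Far.
Variables (z a a' x x' : G) (B Y : {set G}) (c d b b' : G).
Hypothesis dz : deg z = 4.
Hypothesis H : hub z a a' x x' B Y c d b b'.

(* Here [B] and [Y] are also pairs with a unique neighbour of [z], so [G] has nine vertices. *)
Lemma hub_nine : z -- c -> z -- b -> False.
Proof.
move=> zc zb; hub_neqs H.
have fAB := hub_sepA H; have fXY := hub_sepX H; have Na' := hub_a' H; have Nx' := hub_x' H.
have za := hub_za H; have zx := hub_zx H.
have /andP [bB b'B] := hub_in_B H.
have /andP [cY dY] := hub_in_B (hub_sym H).
have [fBA fYX] : fivesep B [set a; a'] /\ fivesep Y [set x; x'] by rewrite fivesepC fAB fivesepC fXY.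
have eT w : (w \in cutset B [set a; a']) = (w \in [:: z; x; x'; c; d]) by rewrite cutsetC (hub_T H).
have eS w : (w \in cutset Y [set x; x']) = (w \in [:: z; a; a'; b; b']) by rewrite cutsetC (hub_S H).
have [||r [sr ur Nz]] := @set_rest _ (nbrs z) [:: a; x; c; b].
- by rewrite /= !inE !negb_or; rewrite_neqs.
- by move=> w; rewrite 4!inE inE => /or4P [] /eqP ->.
rewrite -[#|nbrs z|]/(deg z) dz in sr; case: r sr ur Nz => // _ _ Nz.
have {}Nz w : (z -- w) = (w \in [:: a; x; c; b]) by rewrite -Nz inE.
have NB w : w \in [set a; a'] -> w \notin B.
  by move=> wA; rewrite (sep_disj (fivesep_sep fAB) wA).
have NY w : w \in [set x; x'] -> w \notin Y.
  by move=> wA; rewrite (sep_disj (fivesep_sep fXY) wA).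
have loneB v : v \in B -> z -- v -> v = b.
  move=> vB; rewrite Nz !inE => /or4P [/eqP e|/eqP e|/eqP e|/eqP //]; exfalso.
  - by move: vB; apply/negP/NB; rewrite e !inE eqxx.
  - have : x \in cutset B [set a; a'] by rewrite eT !inE eqxx !orbT.
    by rewrite in_cutset -e vB.
  - have : c \in cutset B [set a; a'] by rewrite eT !inE eqxx !orbT.
    by rewrite in_cutset -e vB.
have loneY v : v \in Y -> z -- v -> v = c.
  move=> vY; rewrite Nz !inE => /or4P [/eqP e|/eqP e|/eqP //|/eqP e]; exfalso.
  - have : a \in cutset Y [set x; x'] by rewrite eS !inE eqxx !orbT.
    by rewrite in_cutset -e vY.
  - by move: vY; apply/negP/NY; rewrite e !inE eqxx.
  - have : b \in cutset Y [set x; x'] by rewrite eS !inE eqxx !orbT.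
    by rewrite in_cutset -e vY.
have [||mb [eB _ _ _ Nb']] := @lone_mate G qG oG blockedG iso4 z x B _ b dz zx fBA _ _ bB zb loneB.
- by rewrite eT !inE eqxx.
- by rewrite eT !inE eqxx !orbT.
have {mb eB Nb'} [eB Nb'] : B = [set b; b'] /\ forall w, (b' -- w) = (w == b) || (w \in [:: x; x'; c; d]).
  move: (b'B); rewrite eB !inE; rewrite_neqs => /= /eqP e; subst mb; split=> // w.
  rewrite Nb' eT !inE; case: (eqVneq w z) => [->|_]; last by rewrite andbT.
  by rewrite_neqs.
have [||md [eY _ _ _ Nd]] := @lone_mate G qG oG blockedG iso4 z a Y _ c dz za fYX _ _ cY zc loneY.
- by rewrite eS !inE eqxx.
- by rewrite eS !inE eqxx !orbT.
have {md eY Nd} [eY Nd] : Y = [set c; d] /\ forall w, (d -- w) = (w == c) || (w \in [:: a; a'; b; b']).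
  move: (dY); rewrite eY !inE; rewrite_neqs => /= /eqP e; subst md; split=> // w.
  rewrite Nd eS !inE; case: (eqVneq w z) => [->|_]; last by rewrite andbT.
  by rewrite_neqs.
have all w : w \in [:: z; a; a'; x; x'; c; d; b; b'].
  case: (boolP (w \in cutset B [set a; a'])); first by rewrite eT !inE; split_eqs w.
  by rewrite in_cutset negb_and !negbK eB !inE; split_eqs w.
have [E [F [f aS0 x'S0 zE]]] := hub_cut dz H.
have sE := fivesep_sep f.
have zF w : z -- w -> w \notin F by apply: sep_nbr sE zE.
have inF w : w \in F -> w \in [:: a'; d; b'].
  move=> wF; have := all w; rewrite !inE.
  case: (eqVneq w z) => [e|_]; first by rewrite e (sep_disj sE zE) in wF.
  case: (eqVneq w a) => [e|_]; first by rewrite e (cutsetNr aS0) in wF.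
  case: (eqVneq w x') => [e|_]; first by rewrite e (cutsetNr x'S0) in wF.
  case: (eqVneq w x) => [e|_]; first by have := zF x zx; rewrite -e wF.
  case: (eqVneq w c) => [e|_]; first by have := zF c zc; rewrite -e wF.
  case: (eqVneq w b) => [e|_]; first by have := zF b zb; rewrite -e wF.
  by split_eqs w.
have inS u w : u \in F -> u -- w -> w \notin F -> w \in cutset E F.
  move=> uF uw wF; rewrite in_cutset wF andbT; apply: (sep_nbr _ uF uw).
  by rewrite sepC.
have six l : uniq l -> {subset l <= cutset E F} -> size l <= 5.
  by move=> ul sl; rewrite -(fivesep_card f); apply: card_ge_uniq.
have [xF cF bF] : [/\ x \notin F, c \notin F & b \notin F] by split; apply: zF.
have a'd : a' -- d by rewrite Na' !inE eqxx !orbT.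
have a'x : a' -- x by rewrite Na' !inE eqxx !orbT.
have a'c : a' -- c by rewrite Na' !inE eqxx !orbT.
have db' : d -- b' by rewrite Nd !inE eqxx !orbT.
have dc : d -- c by rewrite Nd eqxx.
have db : d -- b by rewrite Nd !inE eqxx !orbT.
have b'x : b' -- x by rewrite Nb' !inE eqxx !orbT.
have b'b : b' -- b by rewrite Nb' eqxx.
have one y : (forall w, w \in F -> w = y) -> False.
  move=> Fy; have : 1 < #|F| by case/and4P: f.
  by case/card_gt1P => e1 [e2 [/Fy -> /Fy ->]]; rewrite eqxx.
case: (boolP (a' \in F)) => a'F; case: (boolP (d \in F)) => dF.
- have xS := inS _ _ a'F a'x xF; have cS := inS _ _ a'F a'c cF; have bS := inS _ _ dF db bF.
  have /card_gt1P [e1 [e2 [e1E e2E e12]]] : 1 < #|E| by case/and4P: f.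
  have [e eE ez] : exists2 e, e \in E & e != z.
    by case: (eqVneq e1 z) => [e|?]; [exists e2; rewrite // -e eq_sym | exists e1].
  have := all e; rewrite !inE (negbTE ez) /= => /or4P [/eqP h|/eqP h|/eqP h|/or4P [/eqP h|/eqP h|/eqP h|/orP [] /eqP h]].
  + by rewrite h (cutsetNl aS0) in eE.
  + by rewrite -h (sep_disj sE eE) in a'F.
  + by rewrite h (cutsetNl xS) in eE.
  + by rewrite h (cutsetNl x'S0) in eE.
  + by rewrite h (cutsetNl cS) in eE.
  + by rewrite -h (sep_disj sE eE) in dF.
  + by rewrite h (cutsetNl bS) in eE.
  + by move: db'; rewrite -h sedge_sym (sep_noedge sE eE dF).
- have b'F : b' \in F.
    apply: contraT => b'F; case: (@one a') => w wF; have := inF w wF; rewrite !inE.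
    by case/or3P => /eqP // e; rewrite e in wF; [rewrite wF in dF|rewrite wF in b'F].
  have xS := inS _ _ a'F a'x xF; have cS := inS _ _ a'F a'c cF; have bS := inS _ _ b'F b'b bF.
  have dS := inS _ _ a'F a'd dF.
  suff : 6 <= 5 by [].
  apply: (six [:: a; x'; x; c; b; d]); first by rewrite /= !inE !negb_or; rewrite_neqs.
  by apply/allP; rewrite /= aS0 x'S0 xS cS bS dS.
- have b'F : b' \in F.
    apply: contraT => b'F; case: (@one d) => w wF; have := inF w wF; rewrite !inE.
    by case/or3P => /eqP // e; rewrite e in wF; [rewrite wF in a'F|rewrite wF in b'F].
  have xS := inS _ _ b'F b'x xF; have cS := inS _ _ dF dc cF; have bS := inS _ _ dF db bF.
  have a'S : a' \in cutset E F by apply: (inS d); rewrite // sedge_sym.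
  suff : 6 <= 5 by [].
  apply: (six [:: a; x'; x; c; b; a']); first by rewrite /= !inE !negb_or; rewrite_neqs.
  by apply/allP; rewrite /= aS0 x'S0 xS cS bS a'S.
- case: (@one b') => w wF; have := inF w wF; rewrite !inE.
  by case/or3P => /eqP // e; rewrite e in wF; [rewrite wF in a'F|rewrite wF in dF].
Qed.
End Far.
End Hub.

Section HubFinal.
Variable G : sgraph.
Implicit Types (A B C D E F T X Y : {set G}) (u v w z a x : G).
Hypothesis qG : quasi5 G.
Hypothesis oG : 4 < #|G|.
Hypothesis blockedG : forall x y : G, x -- y -> blocked x y.
Hypothesis iso4 : forall z : G, deg z = 4 -> isolated_four z.

Lemma hub_c z a a' x x' B Y c d b b' :
  deg z = 4 -> hub z a a' x x' B Y c d b b' -> z -- c = false.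
Proof.
move=> dz H; apply/negP => zc; hub_neqs H.
have fAB := hub_sepA H; have za := hub_za H; have zx := hub_zx H.
have /andP [bB b'B] := hub_in_B H.
have fBA : fivesep B [set a; a'] by rewrite fivesepC.
have eT w : (w \in cutset B [set a; a']) = (w \in [:: z; x; x'; c; d]) by rewrite cutsetC (hub_T H).
have [||r [sr ur Nz]] := @set_rest _ (nbrs z) [:: a; x; c].
- by rewrite /= !inE !negb_or; rewrite_neqs.
- by move=> w; rewrite 3!inE inE => /or3P [] /eqP ->.
rewrite -[#|nbrs z|]/(deg z) dz in sr; case: r sr ur Nz => [//|g [|//]] _ _ Nz.
have zT : z \in cutset B [set a; a'] by rewrite eT !inE eqxx.
have inB v : v \in B -> z -- v -> v = g.
  move=> vB zv; have : v \in nbrs z by rewrite inE.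
  rewrite Nz !inE => /or4P [/eqP e|/eqP e|/eqP e|/eqP //]; exfalso.
  - by have := sep_disj (fivesep_sep fAB) (v:=v); rewrite e !inE eqxx /= -e vB => /(_ isT).
  - have : x \in cutset B [set a; a'] by rewrite eT !inE eqxx !orbT.
    by rewrite in_cutset -e vB.
  - have : c \in cutset B [set a; a'] by rewrite eT !inE eqxx !orbT.
    by rewrite in_cutset -e vB.
have [v vB zv] := fivesep_nbr qG fBA zT.
have lone w : w \in B -> z -- w -> w = v by move=> wB zw; rewrite (inB w) // (inB v).
have c2 := lonely_card qG oG blockedG (iso4 dz) fBA zT vB zv lone.
have eB : B = [set b; b'].
  apply/esym/eqP; rewrite eqEcard c2 cards2; rewrite_neqs.
  by apply/subsetP => w; rewrite in_set2 => /orP [] /eqP ->.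
move: vB zv; rewrite eB !inE => /orP [] /eqP -> zb.
  exact: (hub_nine qG oG blockedG iso4 dz H zc zb).
exact: (hub_nine qG oG blockedG iso4 dz (hub_sym (hub_swap (hub_sym H))) zc zb).
Qed.

Lemma hub_far z a a' x x' B Y c d b b' :
  deg z = 4 -> hub z a a' x x' B Y c d b b' ->
  [/\ z -- c = false, z -- d = false, z -- b = false & z -- b' = false].
Proof.
move=> dz H; split.
- exact: hub_c dz H.
- exact: hub_c dz (hub_swap H).
- exact: hub_c dz (hub_sym H).
- exact: hub_c dz (hub_swap (hub_sym H)).
Qed.

Lemma hub_a_x z a a' x x' B Y c d b b' w :
  deg z = 4 -> hub z a a' x x' B Y c d b b' -> a -- w -> z -- w -> w = x.
Proof.
move=> dz H aw; have [zc zd _ _] := hub_far dz H.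
have := hub_nbr_a H aw; rewrite !inE.
case/or3P => [/eqP ->|/eqP ->|/or4P [/eqP -> //|/eqP ->|/eqP ->|/eqP ->]];
  by rewrite ?(hub_za' H) ?(hub_zx' H) ?zc ?zd ?sedge_irr.
Qed.

Lemma four_matching z v w1 w2 :
  deg z = 4 -> z -- v -> z -- w1 -> z -- w2 -> w1 != w2 -> v -- w1 -> v -- w2 -> False.
Proof.
move=> dz zv zw1 zw2 w12 vw1 vw2.
have [a [a' [x [x' [B [Y [c [d [b [b' H]]]]]]]]]] := hub_exists qG oG blockedG iso4 dz.
have Na w : a -- w -> z -- w -> w = x by apply: hub_a_x dz H.
have Nx w : x -- w -> z -- w -> w = a by apply: hub_a_x dz (hub_sym H).
case: (eqVneq v a) => [e|va].
  by rewrite e in vw1 vw2; rewrite (Na _ vw1 zw1) (Na _ vw2 zw2) eqxx in w12.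
case: (eqVneq v x) => [e|vx].
  by rewrite e in vw1 vw2; rewrite (Nx _ vw1 zw1) (Nx _ vw2 zw2) eqxx in w12.
have noax w : v -- w -> (w != a) && (w != x).
  move=> vw; apply/andP; split; apply/eqP => e; rewrite e sedge_sym in vw.
    by rewrite (Na _ vw zv) eqxx in vx.
  by rewrite (Nx _ vw zv) eqxx in va.
have /andP [w1a w1x] := noax _ vw1; have /andP [w2a w2x] := noax _ vw2.
have vw1n : v != w1 by apply: contraTneq vw1 => ->; rewrite sedge_irr.
have vw2n : v != w2 by apply: contraTneq vw2 => ->; rewrite sedge_irr.
hub_neqs H; suff : 5 <= 4 by [].
rewrite -{2}dz; apply: (@card_ge_uniq _ (nbrs z) [:: a; x; v; w1; w2]).
  by rewrite /= !inE !negb_or; rewrite_neqs.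
by apply/allP; rewrite /= !inE (hub_za H) (hub_zx H) zv zw1 zw2.
Qed.

Lemma side_closed C D X (s r : seq G) :
  fivesep C D -> (forall v, v \in X -> v \in C) -> (forall v, v \in C -> v \notin X -> v \in s) ->
  (forall w, w \in cutset C D -> (w \in s) || (w \in r)) ->
  (forall v, v \in X -> v \notin s) ->
  (forall v w, v \in X -> w \in r -> v -- w = false) -> (forall v, v \in D -> v \notin s) ->
  size s <= 4 -> X != set0 ->
  exists m, [/\ X = [set m], deg m = 4 & forall w, (m -- w) = (w \in s)].
Proof.
move=> f XC Cs Sr Xs Xr Ds s4; have sCD := fivesep_sep f; apply: small_closed => //.
- move=> v w vX vw; case: (boolP (w \in X)) => //= wX.
  have wD := sep_nbr sCD (XC v vX) vw.
  case: (boolP (w \in C)) => wC; first exact: Cs.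
  have /Sr /orP [//|wr] : w \in cutset C D by rewrite in_cutset wC.
  by rewrite (Xr v w vX wr) in vw.
- case/and4P: f => _ _ _ D1; apply: leq_trans D1 _; apply: subset_leq_card.
  apply/subsetP => v vD; rewrite !inE negb_or Ds // andbT; apply/negP => /XC vC.
  by rewrite (sep_disj sCD vC) in vD.
Qed.

Section CutThroughHub.
Variables (z a a' x x' : G) (B Y : {set G}) (c d b b' : G) (E F : {set G}).
Hypothesis dz : deg z = 4.
Hypothesis H : hub z a a' x x' B Y c d b b'.
Hypothesis fEF : fivesep E F.
Hypothesis aS : a \in cutset E F.
Hypothesis x'S : x' \in cutset E F.
Hypothesis zE : z \in E.

Let sE : sep E F. Proof. exact: fivesep_sep fEF. Qed.
Let sF : sep F E. Proof. by rewrite sepC. Qed.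

Lemma hub_nbr_x w : x -- w -> w \in [:: x'; z; a; a'; b; b'].
Proof. exact: (hub_nbr_a (hub_sym H)). Qed.

Lemma hub_zF w : z -- w -> w \notin F.
Proof. exact: sep_nbr sE zE. Qed.

Lemma hub_split : a' \in F -> b \in E -> b' \in F -> False.
Proof.
move=> a'F bE b'F; hub_neqs H; have [zc zd zb zb'] := hub_far dz H.
have zx := hub_zx H; have /andP [bB b'B] := hub_in_B H.
have outE w : a' -- w -> w \notin E by apply: sep_nbr sF a'F.
have xS : x \in cutset E F.
  by rewrite in_cutset hub_zF // outE // (hub_a' H) !inE eqxx !orbT.
have [||r [sr ur eS]] := @set_rest _ (cutset E F) [:: a; x'; x].
- by rewrite /= !inE !negb_or; rewrite_neqs.
- by apply/allP; rewrite /= aS x'S xS.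
rewrite (fivesep_card fEF) in sr; case: r sr ur eS => [//|e [//|f [|//]]] _ ur eS.
have eeS : e \in cutset E F by rewrite eS !inE eqxx !orbT.
have ffS : f \in cutset E F by rewrite eS !inE eqxx !orbT.
have cE : c \notin E by apply: outE; rewrite (hub_a' H) !inE eqxx !orbT.
have dE : d \notin E by apply: outE; rewrite (hub_a' H) !inE eqxx !orbT.
have a'E : a' \notin E by rewrite (sep_disj sF a'F).
have b'E : b' \notin E by rewrite (sep_disj sF b'F).
pose X := E :\ z :\ b.
have inX v : v \in X -> [/\ v \in E, v != z & v != b].
  by rewrite !in_setD1 => /and3P [-> -> ->].
have X0 : X = set0.
  apply/eqP; apply: contraT => X0; exfalso.
  have [|||||||m [eX dm Nm]] := @side_closed E F X [:: z; b; e; f] [:: a; x'; x] fEF _ _ _ _ _ _ _ X0 => //.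
  - by move=> v /inX [].
  - move=> v vE; rewrite !in_setD1 vE andbT negb_and !negbK !inE.
    by case/orP => ->; rewrite ?orbT.
  - by move=> w; rewrite eS !inE; split_eqs w.
  - move=> v /inX [vE vz vb]; rewrite !inE !negb_or vz vb.
    by rewrite (cutset_neql vE eeS) (cutset_neql vE ffS).
  - move=> v w /inX [vE vz vb]; rewrite !inE => /or3P [] /eqP ->; apply/negP; rewrite sedge_sym.
    + move/(hub_nbr_a H); rewrite !inE (negbTE vz) /= => /or4P [/eqP h|/eqP h|/eqP h|/orP [] /eqP h];
      by move: vE; rewrite h ?(negbTE a'E) ?(negbTE cE) ?(negbTE dE) ?(cutsetNl xS) ?(cutsetNl x'S).
    + rewrite (hub_x' H) !inE (negbTE vb) /= => /or4P [] /eqP h;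
      by move: vE; rewrite h ?(negbTE a'E) ?(negbTE b'E) ?(cutsetNl xS) ?(cutsetNl aS).
    + move/hub_nbr_x; rewrite !inE (negbTE vz) (negbTE vb) /= => /or4P [] /eqP h;
      by move: vE; rewrite h ?(negbTE a'E) ?(negbTE b'E) ?(cutsetNl aS) ?(cutsetNl x'S).
  - move=> v vF; rewrite !inE !negb_or !(eq_sym v).
    rewrite (sep_neq sE zE vF) (sep_neq sE bE vF).
    by rewrite !(eq_sym _ v) (cutset_neqr vF eeS) (cutset_neqr vF ffS).
  - have : m -- z by rewrite Nm !inE eqxx.
    by rewrite sedge_sym => /(near_adj iso4 dz); rewrite dm.
have onlyE w : w \in E -> (w == z) || (w == b).
  move=> wE; apply: contraT; rewrite negb_or => /andP [wz wb].
  have : w \in X by rewrite !in_setD1 wz wb.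
  by rewrite X0 inE.
have Nb w : b -- w -> w \in [:: x'; x; e; f].
  move=> bw; have wF := sep_nbr sE bE bw.
  case: (boolP (w \in E)) => [/onlyE /orP [] /eqP h|wE].
  - by rewrite h sedge_sym zb in bw.
  - by rewrite h sedge_irr in bw.
  have : w \in cutset E F by rewrite in_cutset wE.
  rewrite eS inE /= => /orP [/eqP h|]; last by rewrite !inE; split_eqs w.
  rewrite h sedge_sym in bw; have := hub_nbr_a H bw; rewrite !inE; rewrite_neqs.
have d4 := deg_le_list Nb.
have bx : b -- x.
  by rewrite (nbrs_list _ Nb) ?(leq_trans _ (deg_ge4 qG oG b)) // !inE eqxx orbT.
have bz : b != z by rewrite eq_sym.
by have := near_dist2 iso4 dz zx (etrans (sedge_sym x b) bx) bz; rewrite ltnNge d4.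
Qed.

End CutThroughHub.

Section CutSides.
Variables (z a a' x x' : G) (B Y : {set G}) (c d b b' : G) (E F : {set G}).
Hypothesis dz : deg z = 4.
Hypothesis H : hub z a a' x x' B Y c d b b'.
Hypothesis fEF : fivesep E F.
Hypothesis aS : a \in cutset E F.
Hypothesis x'S : x' \in cutset E F.
Hypothesis zE : z \in E.

Let sE : sep E F. Proof. exact: fivesep_sep fEF. Qed.
Let sF : sep F E. Proof. by rewrite sepC. Qed.
Let fFE : fivesep F E. Proof. by rewrite fivesepC. Qed.

Lemma hub_a'_out : a' \in F -> False.
Proof.
move=> a'F; hub_neqs H; have zx := hub_zx H.
have outE w : a' -- w -> w \notin E by apply: sep_nbr sF a'F.
have xS : x \in cutset E F.
  by rewrite in_cutset (hub_zF fEF zE zx) outE // (hub_a' H) !inE eqxx !orbT.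
have [v vE x'v] := fivesep_nbr qG fEF x'S.
have bE : (v == b) || (v == b').
  move: x'v; rewrite (hub_x' H) !inE => /or4P [/eqP h|/eqP h|/eqP h|//].
  - by rewrite h (cutsetNl xS) in vE.
  - by rewrite h (cutsetNl aS) in vE.
  - by rewrite h (sep_disj sF a'F) in vE.
case: (boolP (b' \in F)) => b'F.
  case/orP: bE => /eqP h; last by rewrite -h (sep_disj sE vE) in b'F.
  by rewrite h in vE; apply: (hub_split dz H fEF aS x'S zE a'F vE b'F).
case: (boolP (b \in F)) => bF.
  case/orP: bE => /eqP h; first by rewrite -h (sep_disj sE vE) in bF.
  rewrite h in vE.
  exact: (hub_split dz (hub_sym (hub_swap (hub_sym H))) fEF aS x'S zE a'F vE bF).
have [||r [sr ur eS]] := @set_rest _ (cutset E F) [:: a; x'; x].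
- by rewrite /= !inE !negb_or; rewrite_neqs.
- by apply/allP; rewrite /= aS x'S xS.
rewrite (fivesep_card fEF) in sr; case: r sr ur eS => [//|e [//|f [|//]]] _ ur eS.
have eeS : e \in cutset E F by rewrite eS !inE eqxx !orbT.
have ffS : f \in cutset E F by rewrite eS !inE eqxx !orbT.
pose X := F :\ a'.
have inX w : w \in X -> w \in F /\ w != a' by rewrite in_setD1 => /andP [].
have X0 : X != set0.
  have : 1 < #|F| by case/and4P: fEF.
  by rewrite (cardsD1 a') a'F ltnS card_gt0.
have [|||||||m [eX dm Nm]] := @side_closed F E X [:: a'; a; e; f] [:: x'; x] fFE _ _ _ _ _ _ _ X0 => //.
- by move=> w /inX [].
- by move=> w wF; rewrite in_setD1 wF andbT negbK !inE => ->.
- by move=> w; rewrite cutsetC eS !inE; split_eqs w.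
- move=> w /inX [wF wa']; rewrite !inE !negb_or wa'.
  by rewrite (cutset_neqr wF aS) (cutset_neqr wF eeS) (cutset_neqr wF ffS).
- move=> w y /inX [wF wa']; rewrite !inE => /orP [] /eqP ->; apply/negP; rewrite sedge_sym.
  + rewrite (hub_x' H) !inE (negbTE wa') /= => /or4P [] /eqP h;
    by move: wF; rewrite h ?(negbTE bF) ?(negbTE b'F) ?(cutsetNr xS) ?(cutsetNr aS).
  + move/(hub_nbr_x H); rewrite !inE (negbTE wa') /= => /or4P [/eqP h|/eqP h|/eqP h|/orP [] /eqP h];
    by move: wF; rewrite h ?(negbTE bF) ?(negbTE b'F) ?(cutsetNr aS) ?(cutsetNr x'S) ?(sep_disj sE zE).
- move=> w wE; rewrite !inE !negb_or (sep_neq sE wE a'F).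
  by rewrite (cutset_neql wE aS) (cutset_neql wE eeS) (cutset_neql wE ffS).
have mF : m \in F by have := set11 m; rewrite -eX => /inX [].
have mz : m != z by rewrite eq_sym; apply: sep_neq sE zE mF.
have ma : m -- a by rewrite Nm !inE eqxx orbT.
by have := near_dist2 iso4 dz (hub_za H) (etrans (sedge_sym a m) ma) mz; rewrite dm.
Qed.

Lemma hub_corner : d \in F -> b \in F -> False.
Proof.
move=> dF bF; hub_neqs H; have zx := hub_zx H; have za := hub_za H.
have [zc zd zb zb'] := hub_far dz H.
have zF w : z -- w -> w \notin F by apply: hub_zF fEF zE w.
have a'F : a' \notin F by apply/negP; apply: hub_a'_out.
have a'd : a' -- d by rewrite (hub_a' H) !inE eqxx !orbT.
have a'S : a' \in cutset E F.
  by rewrite in_cutset a'F andbT (sep_nbr sF dF) // sedge_sym.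
have xF := zF _ zx.
have nbd w : d -- w -> [/\ w != x, w != x' & w != z].
  move=> dw; split; apply: contraTneq dw => ->; rewrite sedge_sym ?zd //; apply/negP.
    by move/(hub_nbr_x H); rewrite !inE; rewrite_neqs.
  by rewrite (hub_x' H) !inE; rewrite_neqs.
have nbb w : b -- w -> [/\ w != a, w != a' & w != z].
  move=> bw; split; apply: contraTneq bw => ->; rewrite sedge_sym ?zb //; apply/negP.
    by move/(hub_nbr_a H); rewrite !inE; rewrite_neqs.
  by rewrite (hub_a' H) !inE; rewrite_neqs.
case: (boolP (x \in E)) => xE; last first.
  have xS : x \in cutset E F by rewrite in_cutset xE.
  have cE : c \in E.
    have [v vE] := fivesep_nbr qG fEF a'S; rewrite (hub_a' H) !inE => /or4P [/eqP h|/eqP h|/eqP h|/orP [] /eqP h].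
    - by rewrite h (cutsetNl aS) in vE.
    - by rewrite h (cutsetNl xS) in vE.
    - by rewrite h (cutsetNl x'S) in vE.
    - by rewrite -h.
    - by rewrite h (sep_disj sF dF) in vE.
  have b'E : b' \in E.
    have [v vE] := fivesep_nbr qG fEF x'S; rewrite (hub_x' H) !inE => /or4P [/eqP h|/eqP h|/eqP h|/orP [] /eqP h].
    - by rewrite h (cutsetNl xS) in vE.
    - by rewrite h (cutsetNl aS) in vE.
    - by rewrite h (cutsetNl a'S) in vE.
    - by rewrite h (sep_disj sF bF) in vE.
    - by rewrite -h.
  have [||r [sr ur eS]] := @set_rest _ (cutset E F) [:: a; a'; x'; x].
  - by rewrite /= !inE !negb_or; rewrite_neqs.
  - by apply/allP; rewrite /= aS a'S x'S xS.
  rewrite (fivesep_card fEF) in sr; case: r sr ur eS => [//|e [|//]] _ ur eS.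
  have eeS : e \in cutset E F by rewrite eS !inE eqxx !orbT.
  pose X := F :\ d :\ b.
  have inX w : w \in X -> [/\ w \in F, w != d & w != b].
    by rewrite !in_setD1 => /and3P [-> -> ->].
  have X0 : X = set0.
    apply/eqP; apply: contraT => X0; exfalso.
    have [|||||||m [eX dm Nm]] := @side_closed F E X [:: d; b; e] [:: a; a'; x'; x] fFE _ _ _ _ _ _ _ X0 => //.
    - by move=> w /inX [].
    - move=> w wF; rewrite !in_setD1 wF andbT negb_and !negbK !inE.
      by case/orP => ->; rewrite ?orbT.
    - by move=> w; rewrite cutsetC eS !inE; split_eqs w.
    - move=> w /inX [wF wd wb]; rewrite !inE !negb_or wd wb.
      by rewrite (cutset_neqr wF eeS).
    - move=> w y /inX [wF wd wb]; rewrite !inE => /or4P [] /eqP ->; apply/negP; rewrite sedge_sym.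
      + move/(hub_nbr_a H); rewrite !inE (negbTE wd) orbF => /or4P [/eqP h|/eqP h|/eqP h|/orP [] /eqP h];
        by move: wF; rewrite h ?(cutsetNr a'S) ?(cutsetNr xS) ?(cutsetNr x'S) ?(sep_disj sE zE) ?(sep_disj sE cE).
      + rewrite (hub_a' H) !inE (negbTE wd) orbF => /or4P [] /eqP h;
        by move: wF; rewrite h ?(cutsetNr aS) ?(cutsetNr xS) ?(cutsetNr x'S) ?(sep_disj sE cE).
      + rewrite (hub_x' H) !inE (negbTE wb) /= => /or4P [] /eqP h;
        by move: wF; rewrite h ?(cutsetNr aS) ?(cutsetNr xS) ?(cutsetNr a'S) ?(sep_disj sE b'E).
      + move/(hub_nbr_x H); rewrite !inE (negbTE wb) /= => /or4P [/eqP h|/eqP h|/eqP h|/orP [] /eqP h];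
        by move: wF; rewrite h ?(cutsetNr aS) ?(cutsetNr x'S) ?(cutsetNr a'S) ?(sep_disj sE b'E) ?(sep_disj sE zE).
    - move=> w wE; rewrite !inE !negb_or (sep_neq sE wE dF) (sep_neq sE wE bF).
      by rewrite (cutset_neql wE eeS).
    have : deg m <= 3 by apply: (@deg_le_list G m [:: d; b; e]) => w; rewrite Nm.
    by rewrite dm.
  have onlyF w : w \in F -> (w == d) || (w == b).
    move=> wF; apply: contraT; rewrite negb_or => /andP [wd wb].
    have : w \in X by rewrite !in_setD1 wd wb.
    by rewrite X0 inE.
  have Nd w : d -- w -> w \in [:: b; a; a'; e].
    move=> dw; have [wx wx' _] := nbd w dw; have wE := sep_nbr sF dF dw.
    case: (boolP (w \in F)) => [/onlyF /orP [] /eqP h|wF].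
    - by rewrite h sedge_irr in dw.
    - by rewrite h inE eqxx.
    have : w \in cutset E F by rewrite in_cutset wE.
    by rewrite eS !inE (negbTE wx) (negbTE wx'); split_eqs w.
  have Nb w : b -- w -> w \in [:: d; x'; x; e].
    move=> bw; have [wa wa' _] := nbb w bw; have wE := sep_nbr sF bF bw.
    case: (boolP (w \in F)) => [/onlyF /orP [] /eqP h|wF].
    - by rewrite h inE eqxx.
    - by rewrite h sedge_irr in bw.
    have : w \in cutset E F by rewrite in_cutset wE.
    by rewrite eS !inE (negbTE wa) (negbTE wa'); split_eqs w.
  have dd4 : deg d = 4 by apply/eqP; rewrite eqn_leq (deg_ge4 qG oG) (deg_le_list Nd).
  have db : d -- b by rewrite (nbrs_list _ Nd) ?dd4 // inE eqxx.
  by have := near_adj iso4 dd4 db; rewrite ltnNge (deg_le_list Nb).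
have nxb : x -- b = false by rewrite (sep_noedge sE xE bF).
have Nx w : (x -- w) = (w \in [:: x'; z; a; a'; b']).
  apply: nbrs_list => [|{}w xw]; first exact: (near_adj iso4 dz zx).
  have := hub_nbr_x H xw; rewrite !inE; case: (eqVneq w b) => [h|_]; last by split_eqs w.
  by rewrite h nxb in xw.
have xb' : x -- b' by rewrite Nx !inE eqxx !orbT.
have b'F : b' \notin F by apply: sep_nbr sE xE xb'.
have [||r [sr ur eS]] := @set_rest _ (cutset E F) [:: a; a'; x'].
- by rewrite /= !inE !negb_or; rewrite_neqs.
- by apply/allP; rewrite /= aS a'S x'S.
rewrite (fivesep_card fEF) in sr; case: r sr ur eS => [//|e [//|f [|//]]] _ ur eS.
have eeS : e \in cutset E F by rewrite eS !inE eqxx !orbT.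
have ffS : f \in cutset E F by rewrite eS !inE eqxx !orbT.
have ef : e != f by move: ur; rewrite /= !inE => /and5P [_ _ _ ].
case: (boolP (c \in F)) => cF.
  pose X := E :\ x :\ z :\ b'.
  have inX w : w \in X -> [/\ w \in E, w != x, w != z & w != b'].
    by rewrite !in_setD1 => /and4P [-> -> -> ->].
  have X0 : X = set0.
    apply/eqP; apply: contraT => X0; exfalso.
    have sX : sep X F by apply: sep_intro => [w /inX [wE _ _ _] wF|u w /inX [uE _ _ _] wF];
      [rewrite (sep_disj sE wE) in wF|rewrite (sep_noedge sE uE wF)].
    have [||||m [eX dm Nm]] := @small_closed G qG oG X [:: z; b'; e; f] _ _ _ _ X0 => //.
    - move=> v w /inX [vE vx vz vb'] vw; have wF := sep_nbr sE vE vw.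
      have va w' : w' \in [:: a; a'; x'; x] -> v -- w' = false.
        rewrite !inE => /or4P [] /eqP ->; apply/negP; rewrite sedge_sym.
        + move/(hub_nbr_a H); rewrite !inE (negbTE vx) (negbTE vz) /= => /or4P [] /eqP h;
          by move: vE; rewrite h ?(cutsetNl a'S) ?(cutsetNl x'S) ?(sep_disj sF cF) ?(sep_disj sF dF).
        + rewrite (hub_a' H) !inE (negbTE vx) /= => /or4P [] /eqP h;
          by move: vE; rewrite h ?(cutsetNl aS) ?(cutsetNl x'S) ?(sep_disj sF cF) ?(sep_disj sF dF).
        + rewrite (hub_x' H) !inE (negbTE vx) (negbTE vb') orbF /= => /or3P [] /eqP h;
          by move: vE; rewrite h ?(cutsetNl aS) ?(cutsetNl a'S) ?(sep_disj sF bF).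
        + rewrite Nx !inE (negbTE vz) (negbTE vb') orbF /= => /or3P [] /eqP h;
          by move: vE; rewrite h ?(cutsetNl aS) ?(cutsetNl a'S) ?(cutsetNl x'S).
      case: (boolP (w \in E)) => wE.
        rewrite !in_setD1 wE !inE; case: (eqVneq w x) => [h|_]; last by split_eqs w.
        by rewrite va ?h ?inE ?eqxx ?orbT in vw.
      have : w \in cutset E F by rewrite in_cutset wE.
      rewrite eS /=; case: (boolP (w \in [:: a; a'; x'; x])) => [/va|]; first by rewrite vw.
      by rewrite !inE; split_eqs w => *; rewrite orbT.
    - move=> v /inX [vE _ vz vb']; rewrite !inE !negb_or vz vb'.
      by rewrite (cutset_neql vE eeS) (cutset_neql vE ffS).
    - case/and4P: fEF => _ _ _ D1; apply: leq_trans D1 _; apply: subset_leq_card.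
      apply/subsetP => v vF; rewrite in_setC in_setU negb_or; apply/andP; split.
        by rewrite (sep_disj (A:=F) (B:=X)) // sepC.
      rewrite !inE !negb_or (cutset_neqr vF eeS) (cutset_neqr vF ffS) andbT.
      by rewrite (eq_sym v z) (sep_neq sE zE vF) andbT; apply: contraTneq vF => ->.
    have : m -- z by rewrite Nm !inE eqxx.
    by rewrite sedge_sym => /(near_adj iso4 dz); rewrite dm.
  have onlyE w : w \in E -> [|| w == x, w == z | w == b'].
    move=> wE; apply: contraT; rewrite !negb_or => /and3P [wx wz wb'].
    have : w \in X by rewrite !in_setD1 wx wz wb'.
    by rewrite X0 inE.
  have zef w : z -- w -> w != a -> w != x -> (w == e) || (w == f).
    move=> zw wa wx; have wF := zF w zw; case: (boolP (w \in E)) => [/onlyE|wE].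
      rewrite (negbTE wx) /= => /orP [] /eqP h; first by rewrite h sedge_irr in zw.
      by rewrite h zb' in zw.
    have : w \in cutset E F by rewrite in_cutset wE.
    rewrite eS !inE (negbTE wa) /=; case: (eqVneq w a') => [h|_].
      by rewrite h (hub_za' H) in zw.
    by case: (eqVneq w x') => [h|_] //; rewrite h (hub_zx' H) in zw.
  have [||r [sr urz Nz]] := @set_rest _ (nbrs z) [:: a; x].
  - by rewrite /= !inE; rewrite_neqs.
  - by apply/allP; rewrite /= !inE za zx.
  rewrite -[#|nbrs z|]/(deg z) dz in sr; case: r sr urz Nz => [//|g [//|h [|//]]] _ urz Nz.
  have [zg zh] : z -- g /\ z -- h.
    have zN w : w \in [:: a; x; g; h] -> z -- w by move: (Nz w); rewrite inE => <-.
    by split; apply: zN; rewrite !inE eqxx !orbT.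
  move: urz; rewrite /= !inE !negb_or => /and4P [/and3P [_ ag ah] /andP [xg xh] gh _].
  have ge : (g == e) || (g == f) by apply: zef; rewrite // eq_sym.
  have he : (h == e) || (h == f) by apply: zef; rewrite // eq_sym.
  have [ze zf] : z -- e /\ z -- f.
    case/orP: ge => /eqP g1; case/orP: he => /eqP h1; rewrite g1 h1 ?eqxx // in gh zg zh; by split.
  have b'S : b' \notin cutset E F.
    have b'e : b' != e by apply: contraFneq zb' => ->.
    have b'f : b' != f by apply: contraFneq zb' => ->.
    by rewrite eS !inE; rewrite_neqs.
  have b'E : b' \in E by move: b'S; rewrite in_cutset b'F andbT negbK.
  have Nb' w : b' -- w -> w \in [:: x'; x; e; f].
    move=> bw; have wF := sep_nbr sE b'E bw.
    have wa : w != a.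
      apply: contraTneq bw => ->; rewrite sedge_sym; apply/negP.
      by move/(hub_nbr_a H); rewrite !inE; rewrite_neqs.
    have wa' : w != a'.
      by apply: contraTneq bw => ->; rewrite sedge_sym (hub_a' H) !inE; rewrite_neqs.
    case: (boolP (w \in E)) => [/onlyE /or3P [] /eqP i|wE].
    - by rewrite i !inE eqxx orbT.
    - by rewrite i sedge_sym zb' in bw.
    - by rewrite i sedge_irr in bw.
    have : w \in cutset E F by rewrite in_cutset wE.
    by rewrite eS !inE (negbTE wa) (negbTE wa'); split_eqs w.
  have b'z : b' != z by rewrite eq_sym.
  by have := near_dist2 iso4 dz zx xb' b'z; rewrite ltnNge (deg_le_list Nb').
pose X := F :\ d :\ b.
have inX w : w \in X -> [/\ w \in F, w != d & w != b].
  by rewrite !in_setD1 => /and3P [-> -> ->].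
have Fsplit w : w \in F -> [|| w == d, w == b | w \in X].
  by move=> wF; rewrite !in_setD1 wF; case: (w == d); case: (w == b).
have Sef w : w \in cutset E F -> w \in [:: a; a'; x'; e; f] by rewrite eS.
case: (boolP (X == set0)) => [/eqP X0|X0].
  have onlyF w : w \in F -> (w == d) || (w == b).
    by move/Fsplit; rewrite X0 inE orbF.
  have Nb w : b -- w -> w \in [:: d; x'; e; f].
    move=> bw; have [wa wa' _] := nbb w bw; have wE := sep_nbr sF bF bw.
    case: (boolP (w \in F)) => [/onlyF /orP [] /eqP i|wF].
    - by rewrite i inE eqxx.
    - by rewrite i sedge_irr in bw.
    have /Sef : w \in cutset E F by rewrite in_cutset wE.
    by rewrite !inE (negbTE wa) (negbTE wa'); split_eqs w.
  have Nd w : d -- w -> w \in [:: b; a; a'; e; f].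
    move=> dw; have [wx wx' _] := nbd w dw; have wE := sep_nbr sF dF dw.
    case: (boolP (w \in F)) => [/onlyF /orP [] /eqP i|wF].
    - by rewrite i sedge_irr in dw.
    - by rewrite i inE eqxx.
    have /Sef : w \in cutset E F by rewrite in_cutset wE.
    by rewrite !inE (negbTE wx'); split_eqs w.
  have db4 : deg b = 4 by apply/eqP; rewrite eqn_leq (deg_ge4 qG oG) (deg_le_list Nb).
  have {}Nb := nbrs_list (s := [:: d; x'; e; f]) (eq_leq (esym db4)) Nb.
  have bd : b -- d by rewrite Nb inE eqxx.
  have {}Nd := nbrs_list (s := [:: b; a; a'; e; f]) (near_adj iso4 db4 bd) Nd.
  by apply: (four_matching db4 bd _ _ ef); rewrite ?Nb ?Nd !inE eqxx !orbT.
have [|||||||m [eX dm Nm]] := @side_closed F E X [:: d; b; e; f] [:: a; a'; x'] fFE _ _ _ _ _ _ _ X0 => //.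
- by move=> w /inX [].
- by move=> w /Fsplit; rewrite !inE => + wX; rewrite (negbTE wX); split_eqs w.
- by move=> w; rewrite cutsetC eS !inE; split_eqs w.
- move=> w /inX [wF wd wb]; rewrite !inE !negb_or wd wb.
  by rewrite (cutset_neqr wF eeS) (cutset_neqr wF ffS).
- move=> w y /inX [wF wd wb]; rewrite !inE => /or3P [] /eqP ->; apply/negP; rewrite sedge_sym.
  + move/(hub_nbr_a H); rewrite !inE (negbTE wd) orbF => /or4P [/eqP h|/eqP h|/eqP h|/orP [] /eqP h];
    by move: wF; rewrite h ?(cutsetNr a'S) ?(negbTE xF) ?(cutsetNr x'S) ?(sep_disj sE zE) ?(negbTE cF).
  + rewrite (hub_a' H) !inE (negbTE wd) orbF => /or4P [] /eqP h;
    by move: wF; rewrite h ?(cutsetNr aS) ?(negbTE xF) ?(cutsetNr x'S) ?(negbTE cF).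
  + rewrite (hub_x' H) !inE (negbTE wb) /= => /or4P [] /eqP h;
    by move: wF; rewrite h ?(cutsetNr aS) ?(negbTE xF) ?(cutsetNr a'S) ?(negbTE b'F).
- move=> w wE; rewrite !inE !negb_or (sep_neq sE wE dF) (sep_neq sE wE bF).
  by rewrite (cutset_neql wE eeS) (cutset_neql wE ffS).
have Nb w : b -- w -> w \in [:: d; m; x'; e; f].
  move=> bw; have [wa wa' _] := nbb w bw; have wE := sep_nbr sF bF bw.
  case: (boolP (w \in F)) => [/Fsplit|wF].
    rewrite eX !inE; case: (eqVneq w b) => [i|_]; last by split_eqs w.
    by rewrite i sedge_irr in bw.
  have /Sef : w \in cutset E F by rewrite in_cutset wE.
  by rewrite !inE (negbTE wa) (negbTE wa'); split_eqs w.
have mb : m -- b by rewrite Nm !inE eqxx orbT.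
have {}Nb := nbrs_list (s := [:: d; m; x'; e; f]) (near_adj iso4 dm mb) Nb.
have de : d != e by apply: cutset_neqr dF eeS.
by apply: (four_matching dm mb _ _ de); rewrite ?Nm ?Nb !inE eqxx ?orbT.
Qed.

End CutSides.

Lemma no_degree_four z : deg z = 4 -> False.
Proof.
move=> dz; have [a [a' [x [x' [B [Y [c [d [b [b' H]]]]]]]]]] := hub_exists qG oG blockedG iso4 dz.
have [E [F [f aS x'S zE]]] := hub_cut qG oG blockedG iso4 dz H.
have fF : fivesep F E by rewrite fivesepC.
have a'F : a' \notin F by apply/negP; apply: (hub_a'_out dz H f aS x'S zE).
have zF w : z -- w -> w \notin F by apply: hub_zF f zE w.
have [v vF av] : exists2 v, v \in F & a -- v by apply: (fivesep_nbr qG fF); rewrite cutsetC.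
have [w wF x'w] : exists2 w, w \in F & x' -- w by apply: (fivesep_nbr qG fF); rewrite cutsetC.
have cdF : (c \in F) || (d \in F).
  have := hub_nbr_a H av; rewrite !inE => /or4P [/eqP h|/eqP h|/eqP h|/or3P [] /eqP h]; rewrite -?h ?vF ?orbT //.
  - by rewrite h (negbTE a'F) in vF.
  - by rewrite h (sep_disj (fivesep_sep f) zE) in vF.
  - by rewrite h (negbTE (zF x (hub_zx H))) in vF.
  - by rewrite h (cutsetNr x'S) in vF.
have bbF : (b \in F) || (b' \in F).
  move: x'w; rewrite (hub_x' H) !inE => /or4P [/eqP h|/eqP h|/eqP h|/orP [] /eqP h]; rewrite -?h ?wF ?orbT //.
  - by rewrite h (negbTE (zF x (hub_zx H))) in wF.
  - by rewrite h (cutsetNr aS) in wF.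
  - by rewrite h (negbTE a'F) in wF.
have Hb := hub_sym (hub_swap (hub_sym H)).
case/orP: cdF => [cF|dF]; case/orP: bbF => [bF|bF].
- exact: (hub_corner dz (hub_swap H) f aS x'S zE cF bF).
- exact: (hub_corner dz (hub_swap Hb) f aS x'S zE cF bF).
- exact: (hub_corner dz H f aS x'S zE dF bF).
- exact: (hub_corner dz Hb f aS x'S zE dF bF).
Qed.

End HubFinal.

(** * The theorem *)

Section Distance.
Variable G : sgraph.
Implicit Types x y w : G.

Lemma is_dist1 x y : x -- y -> is_dist x y 1.
Proof.
move=> xy; have nxy : x != y by apply: contraTneq xy => ->; rewrite sedge_irr.
split; first by exists [:: y]; rewrite // /is_path_to /= xy inE nxy eqxx.
by case=> // /and3P [_ _ /= e]; rewrite e in nxy.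
Qed.

Lemma is_dist2 x w y : x != y -> x -- y = false -> x -- w -> w -- y -> is_dist x y 2.
Proof.
move=> nxy nadj xw wy; split.
  have nxw : x != w by apply: contraTneq xw => ->; rewrite sedge_irr.
  have nwy : w != y by apply: contraTneq wy => ->; rewrite sedge_irr.
  by exists [:: w; y]; rewrite // /is_path_to /= xw wy !inE negb_or nxw nxy nwy eqxx.
case=> [|u [|//]] /and3P [p _ /= /eqP e]; first by rewrite e eqxx in nxy.
by move: p; rewrite /= e nadj.
Qed.

End Distance.

Theorem theorem2 (G : sgraph) (hG : quasi_connected 5 G)
  (hdeg : forall x y : G, is_dist x y 1 \/ is_dist x y 2 ->
     9 <= deg x + deg y) :
  exists x y : G, quasi_contractible 5 x y.
Proof.
have qG := quasi_connected_quasi5 hG.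
have oG : 4 < #|G| by case: hG => -[].
have adj9 (x y : G) : x -- y -> 9 <= deg x + deg y.
  by move=> xy; apply: hdeg; left; apply: is_dist1.
have iso4 (z : G) : deg z = 4 -> isolated_four z.
  move=> dz m mz near; suff : 9 <= deg z + deg m by rewrite dz.
  case zm: (z -- m); first exact: adj9.
  move: near; rewrite zm => /existsP [w /andP [zw wm]].
  by apply: hdeg; right; apply: is_dist2 zw wm; rewrite // eq_sym.
have oG6 : 5 < #|G|.
  rewrite ltn_neqAle oG andbT; apply/eqP => e5.
  have le4 (v : G) : deg v <= 4.
    have : #|v |: nbrs v| <= #|G| by apply: max_card.
    by rewrite cardsU1 inE sedge_irr -e5.
  have /card_gt0P [x _] : 0 < #|G| by rewrite -e5.
  have /card_gt0P [y] : 0 < #|nbrs x| by apply: leq_trans (deg_ge4 qG oG x).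
  rewrite inE => /adj9; rewrite leqNgt ltnS => /negP; apply.
  exact: (leq_add (le4 x) (le4 y)).
case: (boolP [exists x : G, exists y : G, (x -- y) && ~~ blocked x y]).
  case/existsP => x /existsP [y /andP [xy]].
  rewrite negb_or !negb_exists => /andP [/forallP no4 /forallP no5].
  exists x, y; apply: quasi_contractible_edge => // [z zx zy|A B fAB xT].
    by have := no4 z; rewrite zx zy.
  have := no5 A; rewrite negb_exists => /forallP/(_ B).
  by rewrite fAB xT.
rewrite negb_exists => /forallP none; exfalso.
have blockedG (x y : G) : x -- y -> blocked x y.
  move=> xy; have := none x; rewrite negb_exists => /forallP/(_ y).
  by rewrite xy negbK.
case: (boolP [exists z : G, deg z == 4]) => [/existsP [z /eqP dz]|].
  exact: no_degree_four qG oG blockedG iso4 z dz.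
rewrite negb_exists => /forallP no4.
apply: (five_connected_absurd qG oG blockedG) => v.
by rewrite ltn_neqAle eq_sym no4 (deg_ge4 qG oG).
Qed.
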